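(* If a domain $U\subset\mathbb{C}^n$ is pseudoconvex, then it satisfies the continuity principle.
   Context: A domain is a connected open set. A function $f\colon U\to\mathbb{R}$ is an exhaustion function for $U$ if $f^{-1}((-\infty,r])$ is compact for every $r\in\mathbb{R}$. An upper-semicontinuous function $f\colon V\to[-\infty,\infty)$ on an open set $V\subset\mathbb{C}$ is subharmonic if for every closed disc $\overline{B(a,r)}\subset V$ ($r>0$) and every continuous $\phi\colon\overline{B(a,r)}\to\mathbb{R}$ that is harmonic on $B(a,r)$ with $\phi\ge f$ on $\partial B(a,r)$, one has $\phi\ge f$ on $B(a,r)$. An upper-semicontinuous $f\colon V\to[-\infty,\infty)$ on an open $V\subset\mathbb{C}^n$ is plurisubharmonic if for every $a\in V$ and $\delta\in\mathbb{C}^n$ with $|\delta|=1$ the function $z\mapsto f(a+\delta z)$ is subharmonic on $\{z\in\mathbb{C}: a+\delta z\in V\}$. A domain $U\subset\mathbb{C}^n$ is pseudoconvex if it admits a continuous plurisubharmonic exhaustion function $U\to\mathbb{R}$. Write $B(0,1)$ for the open unit disc in $\mathbb{C}$. A holomorphic disc is a continuous map $S\colon\overline{B(0,1)}\to\mathbb{C}^n$ whose restriction to $B(0,1)$ is holomorphic; the image $S(B(0,1))$ is also denoted $S$, and the boundary is $\partial S:=S(\partial B(0,1))$. For sets $S_j,S$ in $\mathbb{C}^n$, $S_j\to S$ means: for every $\epsilon>0$ there is $J$ such that for all $j\ge J$, $S_j$ is contained in the $\epsilon$-enlargement of $S$ and $S$ is contained in the $\epsilon$-enlargement of $S_j$ (enlargements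 with respect to the $L^\infty$ metric $\max_k|z_k-w_k|$). A domain $U\subset\mathbb{C}^n$ satisfies the continuity principle if for every sequence $\{S_j\}_{j\ge1}$ of holomorphic discs with $S_j\cup\partial S_j\subset U$ for all $j$, $\partial S_j\to B$ and $S_j\to T$, where $B\subset U$ and $T\subset\mathbb{C}^n$ are compact, one has $T\subset U$. *)

(* Defs.v *)
From HB Require Import structures.
From mathcomp Require Import all_boot all_order all_algebra.
From mathcomp Require Export complex.
From mathcomp Require Import all_classical all_reals all_analysis.

Set Implicit Arguments.
Unset Strict Implicit.
Unset Printing Implicit Defensive.

Import Order.TTheory GRing.Theory Num.Theory.
Import numFieldNormedType.Exports.

Local Open Scope classical_set_scope.
Local Open Scope complex_scope.
Local Open Scope ring_scope.

(* mathcomp-analysis puts a topology on abstract numFieldTypes only; give the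
   concrete type R[i] the topology of its modulus, as a module over itself. *)
HB.instance Definition _ (R : rcfType) :=
  PseudoPointedMetric.copy R[i] R[i]^o.
HB.instance Definition _ (R : rcfType) :=
  NormedModule.copy R[i] R[i]^o.

Section Discs.
Variable R : realType.
Implicit Types (a : R[i]) (r : R).

Definition open_disc a r : set R[i] := [set z | `|z - a| < r%:C].
Definition closed_disc a r : set R[i] := [set z | `|z - a| <= r%:C].
Definition circle a r : set R[i] := [set z | `|z - a| = r%:C].

End Discs.

Section Harmonic.
Variable R : realType.
Implicit Types (V : set R[i]) (phi : R[i] -> R).

Definition along_x phi (z : R[i]) : R -> R := fun t => phi (z + (t +i* 0)).
Definition along_y phi (z : R[i]) : R -> R := fun t => phi (z + (0 +i* t)).

Definition partial_x phi : R[i] -> R := fun z => derive1 (along_x phi z) 0.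
Definition partial_y phi : R[i] -> R := fun z => derive1 (along_y phi z) 0.

Definition C1_on V phi := forall z, V z ->
  [/\ derivable (along_x phi z) 0 1, derivable (along_y phi z) 0 1,
      {for z, continuous (partial_x phi)} &
      {for z, continuous (partial_y phi)}].

Definition harmonic_on V phi :=
  [/\ C1_on V phi, C1_on V (partial_x phi), C1_on V (partial_y phi) &
      forall z, V z ->
        partial_x (partial_x phi) z + partial_y (partial_y phi) z = 0].

End Harmonic.

(* For f : T -> \bar R, only the values of f on V matter. *)
Definition upper_semicontinuous_on (R : realType) (T : topologicalType)
    (V : set T) (f : T -> \bar R) :=
  forall x, V x -> forall b : R, (f x < b%:E)%E ->
    \forall y \near within V (nbhs x), (f y < b%:E)%E.

Definition subharmonic_on (R : realType) (V : set R[i]) (f : R[i] -> \bar R) :=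
  [/\ forall z, V z -> (f z < +oo)%E,
      upper_semicontinuous_on V f &
      forall (a : R[i]) (r : R), 0 < r -> closed_disc a r `<=` V ->
      forall phi : R[i] -> R,
        {within closed_disc a r, continuous phi} ->
        harmonic_on (open_disc a r) phi ->
        (forall z, circle a r z -> (f z <= (phi z)%:E)%E) ->
        forall z, open_disc a r z -> (f z <= (phi z)%:E)%E].

(* C^n is 'rV[R[i]]_n.  The library norm `|z| on it is the max norm (valued
   in R[i]); directions of complex lines are instead normalised by the
   Euclidean norm, hence the explicit sum of squares below. *)
Section SeveralVariables.
Variables (R : realType) (n : nat).
Local Notation Cn := 'rV[R[i]]_n.
Implicit Types (U V : set Cn).

Definition plurisubharmonic_on V (f : Cn -> \bar R) :=
  [/\ forall z, V z -> (f z < +oo)%E,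
      upper_semicontinuous_on V f &
      forall a delta : Cn, V a -> \sum_(k < n) `|delta 0 k| ^+ 2 = 1 ->
        subharmonic_on [set z : R[i] | V (a + z *: delta)]
                       (fun z => f (a + z *: delta))].

Definition domain U := open U /\ connected U.

Definition exhaustion U (u : Cn -> R) :=
  forall r : R, compact (U `&` [set z | u z <= r]).

Definition pseudoconvex U := exists u : Cn -> R,
  [/\ {within U, continuous u},
      plurisubharmonic_on U (fun z => (u z)%:E) &
      exhaustion U u].

(* Only the values of S on the closed unit disc matter; derivability along 1
   over the field R[i] is complex differentiability. *)
Definition holomorphic_disc (S : R[i] -> Cn) :=
  {within closed_disc 0 1, continuous S} /\
  forall z, open_disc 0 1 z -> derivable S z 1.

Definition disc_image (S : R[i] -> Cn) : set Cn := S @` open_disc 0 1.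
Definition disc_boundary (S : R[i] -> Cn) : set Cn := S @` circle 0 1.

Definition enlargement (eps : R) (A : set Cn) : set Cn :=
  [set z | exists2 w, A w & `|z - w| < eps%:C].

Definition set_converges (A_ : nat -> set Cn) (A : set Cn) :=
  forall eps : R, 0 < eps -> exists J : nat, forall j : nat, (J <= j)%N ->
    A_ j `<=` enlargement eps A /\ A `<=` enlargement eps (A_ j).

Definition continuity_principle U :=
  forall (S : nat -> R[i] -> Cn) (B T : set Cn),
    (forall j, holomorphic_disc (S j)) ->
    (forall j, disc_image (S j) `|` disc_boundary (S j) `<=` U) ->
    compact B -> B `<=` U -> compact T ->
    set_converges (fun j => disc_boundary (S j)) B ->
    set_converges (fun j => disc_image (S j)) T ->
    T `<=` U.

End SeveralVariables.

(* Main.v *)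
(* Let [u] be a continuous plurisubharmonic exhaustion of [U]. The boundaries of
   the discs [S_j] accumulate on a compact subset of [U], so [u <= m + 1] on them
   for [j] large; by the maximum principle [u <= m + 1] on [S_j], and the limit
   [T] stays in the compact set [u <= m + 1].

   The maximum principle for [u] on a curved disc is the point. Since [u] is only
   continuous and only tested on straight complex lines, it is proved by doubling
   variables, which needs a second-order Taylor expansion of the disc at each
   point. A continuous disc that is merely complex differentiable is uniformly
   approximated by discs having such expansions: Goursat's bisection gives a
   primitive [F] of each component [f], and [(F (z + h) - F z) / h] is close to
   [f] and has the derivative [(f (z + h) - f z) / h]; this is done twice. *)

Require Import Defs.
From mathcomp Require Import all_boot all_order all_algebra.
From mathcomp Require Import complex.
From mathcomp Require Import all_classical all_reals all_analysis.
From mathcomp Require Import ring lra.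
Import numFieldNormedType.Exports.
Local Open Scope classical_set_scope.
Local Open Scope complex_scope.
Local Open Scope ring_scope.

Set Implicit Arguments.
Unset Strict Implicit.
Unset Printing Implicit Defensive.
Import Order.TTheory GRing.Theory Num.Theory.

(** A mere [O(|h|^2)] bound for the deviation of the disc from its tangent line would not do: the
    penalty [c |v|^2] comes with a large [c], and its variation has to be beaten by the fixed strict
    term [e |h|^2]. With a complex expansion the deviation is [b h^2 + o(|h|^2)], so the variation
    of the penalty is, up to an arbitrarily small multiple of [|h|^2], the real part of a complex
    quadratic. That part is harmonic and goes into the test function; so does [e |z0 + h|^2] once
    [e |h|^2] is removed. Real parts of complex quadratic polynomials are thus the only harmonic
    functions against which [u] is tested.

    Complex differentiability comes without continuity of the derivative, which is what leads to
    Goursat's bisection. That stage works with pairs of real functions: [p + iq] is encoded by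
    gradients of Cauchy-Riemann form, and the estimates reduce to the real mean value theorem. *)

(** * Real calculus with explicit first-order remainders *)

Section OneVariable.
Variable R : realType.
Implicit Types (g : R -> R) (x l : R).

(** The remainder is compared with [e * |s|] instead of a quotient with a limit: [s = 0] is
    included, and the form carries over to two variables in [has_grad]. *)
Definition has_deriv g x l := forall e, 0 < e -> exists2 d, 0 < d &
  forall s, `|s| < d -> `|g (x + s) - g x - l * s| <= e * `|s|.

Lemma has_deriv_is_derive g x l : has_deriv g x l -> is_derive x 1 g l.
Proof.
move=> gl.
suff H : h^-1 *: (g (h *: 1 + x) - g x) @[h --> 0^'] --> l.
  exact: (DeriveDef (cvgP _ H) (cvg_lim (@Rhausdorff R) H)).
apply/cvgrPdist_le => e e0; have [d d0 gd] := gl _ e0.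
near=> h.
have h0 : h != 0 by near: h; exact: nbhs_dnbhs_neq.
have hd : `|h| < d by near: h; apply: dnbhs0_lt.
have hp : 0 < `|h| by rewrite normr_gt0.
rewrite -(ler_pM2r hp) -normrM.
have -> : (l - h^-1 *: (g (h *: 1 + x) - g x)) * h =
    - (g (x + h) - g x - l * h).
  rewrite /GRing.scale /= mulr1 (addrC h x); field; exact: h0.
by rewrite normrN; exact: gd.
Unshelve. all: by end_near. Qed.

Lemma derivable_has_deriv g x : derivable g x 1 -> has_deriv g x (derive1 g x).
Proof.
move=> /cvg_ex[/= l H] e e0.
have -> : derive1 g x = l by rewrite derive1E; apply: (cvg_lim (@Rhausdorff R) H).
move/cvgrPdist_le : H => /(_ _ e0); rewrite /dnbhs/= near_withinE near_simpl.
move=> /nbhs_ballP[d /= d0 gd]; exists d => // s sd.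
have [->|s0] := eqVneq s 0.
  by rewrite addr0 subrr mulr0 subrr normr0 mulr0.
have hp : 0 < `|s| by rewrite normr_gt0.
have := gd s; rewrite /ball/= sub0r normrN => /(_ sd s0).
rewrite -(ler_pM2r hp) -normrM.
have -> : (l - s^-1 *: (g (s *: 1 + x) - g x)) * s =
    - (g (x + s) - g x - l * s).
  rewrite /GRing.scale /= mulr1 (addrC s x); field; exact: s0.
by rewrite normrN.
Qed.

Lemma has_deriv_continuous g x l : has_deriv g x l -> {for x, continuous g}.
Proof.
move=> /has_deriv_is_derive gl.
by apply/differentiable_continuous/derivable1_diffP.
Qed.

Lemma has_deriv_MVT01 g (dg : R -> R) :
  (forall x, 0 <= x <= 1 -> has_deriv g x (dg x)) ->
  exists2 c, 0 <= c <= 1 & g 1 - g 0 = dg c.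
Proof.
move=> gd.
have [||c] := @MVT_segment R g dg 0 1 ler01.
- move=> x; rewrite in_itv /= => /andP[x0 x1].
  by apply/has_deriv_is_derive/gd; rewrite !ltW.
- apply: continuous_in_subspaceT => x; rewrite inE /= in_itv /= => x01.
  exact: has_deriv_continuous (gd _ x01).
by rewrite in_itv /= subr0 mulr1 => c01 ->; exists c.
Qed.

Lemma has_deriv_affine g a h x l :
  has_deriv g (a + x * h) l -> has_deriv (fun t => g (a + t * h)) x (l * h).
Proof.
move=> gl e e0; have h1 : 0 < `|h| + 1 by rewrite ltr_wpDl.
have [d d0 gd] := gl (e / (`|h| + 1)) (divr_gt0 e0 h1).
exists (d / (`|h| + 1)); first exact: divr_gt0.
move=> s; rewrite ltr_pdivlMr // => sd.
have sh : `|s * h| < d.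
  by rewrite normrM (le_lt_trans _ sd)// ler_wpM2l// lerDl.
have -> : l * h * s = l * (s * h) by ring.
have := gd _ sh; rewrite mulrDl addrA => /le_trans; apply.
rewrite normrM -mulrA ler_wpM2l ?(ltW e0)// mulrCA ler_piMr//.
by rewrite mulrC ler_pdivrMr// mul1r lerDl.
Qed.

(** The intermediate point is given as a fraction [t] of the step, so that [h] may be negative or
    zero. *)
Lemma has_deriv_MVT g (dg : R -> R) a h :
  (forall t, 0 <= t <= 1 -> has_deriv g (a + t * h) (dg (a + t * h))) ->
  exists2 t, 0 <= t <= 1 & g (a + h) - g a = dg (a + t * h) * h.
Proof.
move=> gd.
have [t t01] := @has_deriv_MVT01 (fun t => g (a + t * h))
  (fun t => dg (a + t * h) * h) (fun x x01 => has_deriv_affine (gd x x01)).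
by rewrite mul1r mul0r addr0; exists t.
Qed.

Lemma has_derivB g1 g2 x l1 l2 :
  has_deriv g1 x l1 -> has_deriv g2 x l2 -> has_deriv (fun t => g1 t - g2 t) x (l1 - l2).
Proof.
move=> h1 h2 e e0; have e2 : 0 < e / 2 by rewrite divr_gt0.
have [d1 d10 {}h1] := h1 _ e2; have [d2 d20 {}h2] := h2 _ e2.
exists (Num.min d1 d2) => [|s]; first by rewrite lt_min d10.
rewrite lt_min => /andP[/h1 {}h1 /h2 {}h2].
have -> : g1 (x + s) - g2 (x + s) - (g1 x - g2 x) - (l1 - l2) * s =
   (g1 (x + s) - g1 x - l1 * s) - (g2 (x + s) - g2 x - l2 * s) by ring.
by apply: (le_trans (ler_normB _ _)); lra.
Qed.

Lemma has_deriv_ext g1 g2 x l r : 0 < r -> (forall s, `|s| < r -> g1 (x + s) = g2 (x + s)) ->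
  has_deriv g1 x l -> has_deriv g2 x l.
Proof.
move=> r0 g12 h e e0; have [d d0 {}h] := h _ e0.
exists (Num.min d r) => [|s]; first by rewrite lt_min d0.
rewrite lt_min => /andP[sd sr]; rewrite -g12//.
have := g12 0; rewrite normr0 addr0 => <- //; exact: h.
Qed.

Lemma primitive_exists g (m : R) :
  (forall x, `|x| <= m -> {for x, continuous g}) ->
  exists G, forall x, `|x| < m -> has_deriv G x (g x).
Proof.
move=> gc.
have gi : (lebesgue_measure).-integrable `[(- m), m] (EFin \o g).
  apply: continuous_compact_integrable; first exact: segment_compact.
  apply: continuous_in_subspaceT => x; rewrite inE /= in_itv /= => xm.
  by apply: gc; rewrite ler_norml.
exists (fun x => (\int[lebesgue_measure]_(t in [set` `[(- m)%R, x]]) (g t))%R) => x xm.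
have /andP[mx xm'] : - m < x < m by rewrite -ltr_norml.
have [dG <-] := continuous_FTC1_closed xm' gi mx (gc _ (ltW xm)).
exact: derivable_has_deriv.
Qed.

End OneVariable.

(** * Goursat's lemma *)

Section Goursat.
Variable R : realType.
Implicit Types (p q E : R -> R -> R).

(** Total differentiability at a single point; nothing is asked of the partial derivatives
    nearby. *)
Definition has_grad p x y A B := forall e, 0 < e -> exists2 d, 0 < d &
  forall s t, `|s| < d -> `|t| < d ->
    `|p (x + s) (y + t) - p x y - (A * s + B * t)| <= e * (`|s| + `|t|).

(** Additive when the rectangle is subdivided. Its vanishing on the rectangles with a corner at the
    origin says that [E] is a function of [x] plus a function of [y]. *)
Definition mixed_diff E x y h k :=
  E (x + h) (y + k) - E x (y + k) - E (x + h) y + E x y.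

Lemma geometric_small (d : R) : 0 < d -> exists n, (1 / 2) ^+ n < d.
Proof.
move=> d0; have /archi_boundP : 0 <= d^-1 by rewrite invr_ge0 ltW.
set n := Num.bound _ => dn; exists n.
have n2 : n%:R < 2 ^+ n :> R by rewrite -natrX ltr_nat ltn_expl.
by rewrite div1r exprVn invf_plt ?posrE ?exprn_gt0// (lt_trans dn).
Qed.

Section Bisection.
Variable E : R -> R -> R.

Let M (z : R * R) w := `|mixed_diff E z.1 z.2 w w|.

(** Chooses a quarter of the square that carries at least a quarter of the mixed difference; if the
    first three fail, additivity forces the last. *)
Let next w (z : R * R) : R * R :=
  let v := w / 2 in
  if M z w <= 4 * M z v then z else
  if M z w <= 4 * M (z.1 + v, z.2) v then (z.1 + v, z.2) else
  if M z w <= 4 * M (z.1, z.2 + v) v then (z.1, z.2 + v) else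
  (z.1 + v, z.2 + v).

Let next_large w z : M z w <= 4 * M (next w z) (w / 2).
Proof.
rewrite /next; case: ifP => // /negbT; rewrite -ltNge => h1.
case: ifP => // /negbT; rewrite -ltNge => h2.
case: ifP => // /negbT; rewrite -ltNge => h3.
rewrite leNgt; apply/negP => h4.
(* The mixed differences of the four quarters add up to that of the square, so four strict deficits
   are contradictory. *)
suff : M z w <= M z (w / 2) + M (z.1 + w / 2, z.2) (w / 2) +
    M (z.1, z.2 + w / 2) (w / 2) + M (z.1 + w / 2, z.2 + w / 2) (w / 2).
  by move: h1 h2 h3 h4; lra.
rewrite /M /mixed_diff /=.
have -> : z.1 + w = z.1 + w / 2 + w / 2 by lra.
have -> : z.2 + w = z.2 + w / 2 + w / 2 by lra.
have norm4 (a b c d : R) : `|a + b + c + d| <= `|a| + `|b| + `|c| + `|d|.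
  by do 3 (apply: (le_trans (ler_normD _ _)); rewrite ?lerD2r).
apply: le_trans (norm4 _ _ _ _).
by rewrite le_eqVlt; apply/orP; left; apply/eqP; congr (`| _ |); ring.
Qed.

Let next_near w z : 0 < w ->
  [/\ z.1 <= (next w z).1, (next w z).1 + w / 2 <= z.1 + w,
      z.2 <= (next w z).2 & (next w z).2 + w / 2 <= z.2 + w].
Proof. by move=> w0; rewrite /next; (do ?case: ifP => _ /=); split; lra. Qed.

Let w n : R := (1 / 2) ^+ n.
Let w_gt0 n : 0 < w n. Proof. by rewrite exprn_gt0// divr_gt0. Qed.
Let wS n : w n.+1 = w n / 2. Proof. by rewrite /w exprSr; lra. Qed.

Let z := fix z n := if n is n'.+1 then next (w n') (z n') else (0, 0).

Let z_large n : M (0, 0) 1 * w n ^+ 2 <= M (z n) (w n).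
Proof.
elim: n => [|n ih]; first by rewrite /w expr0 expr1n mulr1.
by have := next_large (w n) (z n); rewrite wS /=; move: ih; lra.
Qed.

Let nested (u : nat -> R) :
  (forall n, u n <= u n.+1 /\ u n.+1 + w n.+1 <= u n + w n) ->
  forall m n, u m <= u n + w n.
Proof.
move=> h.
have up m n : (m <= n)%N -> u m <= u n.
  by move=> /subnK <-; elim: (n - m)%N => //= k /le_trans; apply; apply: (h _).1.
have dn m n : (m <= n)%N -> u n + w n <= u m + w m.
  by move=> /subnK <-; elim: (n - m)%N => //= k; apply: le_trans; apply: (h _).2.
move=> m n; have [mn|/ltnW nm] := leqP m n.
  by rewrite (le_trans (up _ _ mn))// lerDl ltW.
by rewrite (le_trans _ (dn _ _ nm))// lerDl ltW.
Qed.

Let limit (u : nat -> R) :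
  (forall n, u n <= u n.+1 /\ u n.+1 + w n.+1 <= u n + w n) ->
  exists x, forall n, u n <= x <= u n + w n.
Proof.
move=> h; have nu := nested h; exists (sup (range u)) => n.
apply/andP; split.
  apply: ub_le_sup; last by exists n.
  by exists (u 0%N + w 0%N) => _ [m _ <-].
apply: ge_sup; first by exists (u 0%N), 0%N.
by move=> _ [m _ <-].
Qed.

(** Were the value [M] on the unit square nonzero, bisection would yield squares of side [w n]
    shrinking to a point, each with a mixed difference of at least [M * w n ^+ 2]; the local bound
    at that point with [e = M / 2] forbids it. Only squares containing [(x, y)] enter the local
    bound, which is what differentiability at [(x, y)] can control. *)
Lemma square_bisection :
  (forall x y, 0 <= x <= 1 -> 0 <= y <= 1 -> forall e, 0 < e ->
    exists2 d, 0 < d & forall x' y' v, 0 < v -> v < d ->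
      0 <= x' -> x' + v <= 1 -> 0 <= y' -> y' + v <= 1 ->
      x' <= x <= x' + v -> y' <= y <= y' + v ->
      `|mixed_diff E x' y' v v| <= e * v ^+ 2) ->
  mixed_diff E 0 0 1 1 = 0.
Proof.
move=> local; apply/eqP; rewrite -normr_le0 leNgt; apply/negP => M0.
have step n : [/\ (z n).1 <= (z n.+1).1, (z n.+1).1 + w n.+1 <= (z n).1 + w n,
    (z n).2 <= (z n.+1).2 & (z n.+1).2 + w n.+1 <= (z n).2 + w n].
  by rewrite wS /=; exact: next_near.
have s1 n : (z n).1 <= (z n.+1).1 /\ (z n.+1).1 + w n.+1 <= (z n).1 + w n.
  by case: (step n).
have s2 n : (z n).2 <= (z n.+1).2 /\ (z n.+1).2 + w n.+1 <= (z n).2 + w n.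
  by case: (step n).
have inside n : [/\ 0 <= (z n).1, (z n).1 + w n <= 1, 0 <= (z n).2 &
    (z n).2 + w n <= 1].
  elim: n => [|n [h1 h2 h3 h4]]; first by rewrite /w expr0 /= add0r.
  by case: (step n) => *; split; lra.
have [x hx] := limit s1; have [y hy] := limit s2.
have [|||d d0 hd] := local x y _ _ (M (0, 0) 1 / 2).
- by have := hx 0%N; rewrite /w expr0 /= add0r.
- by have := hy 0%N; rewrite /w expr0 /= add0r.
- exact: divr_gt0.
have [n nd] := geometric_small d0.
have [h1 h2 h3 h4] := inside n.
have := hd _ _ _ (w_gt0 n) nd h1 h2 h3 h4 (hx n) (hy n).
have := z_large n; rewrite /M => /le_trans h /h.
by rewrite ler_pM2r ?exprn_gt0// => ?; move: M0; rewrite /M /= in h *; lra.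
Qed.

End Bisection.

(* The circulation of [p dx + q dy] around a rectangle is the mixed difference
   of [Q - P], where [P] and [Q] are partial primitives of [p] and [q]. *)
Lemma goursat_rectangle p q P Q a c h k :
  (forall s t, 0 <= s <= 1 -> 0 <= t <= 1 ->
     let x := a + s * h in let y := c + t * k in
     [/\ has_deriv (P ^~ y) x (p x y), has_deriv (Q x) y (q x y) &
      exists A B C, has_grad p x y A B /\ has_grad q x y B C]) ->
  mixed_diff (fun x y => Q x y - P x y) a c h k = 0.
Proof.
move=> H.
have := @square_bisection (fun s t => Q (a + s * h) (c + t * k) - P (a + s * h) (c + t * k)).
rewrite /mixed_diff !add0r !mul0r !mul1r !addr0; apply.
move=> s t s01 t01 e e0; set x := a + s * h; set y := c + t * k.
have [_ _ [A [B [C [dp dq]]]]] := H s t s01 t01.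
set N := `|h| + `|k| + 1.
have N0 : 0 < N by rewrite ltr_wpDl// addr_ge0.
(* Four remainders, each at most [e / (4 * N ^+ 2) * (v * N)] and multiplied by a side of length at
   most [v * N], add up to [e * v ^+ 2]. *)
have e'0 : 0 < e / (4 * N ^+ 2) by rewrite divr_gt0// mulr_gt0// exprn_gt0.
have [d1 d10 {}dp] := dp _ e'0; have [d2 d20 {}dq] := dq _ e'0.
exists (Num.min d1 d2 / N) => [|s' t' v v0 vd s'0 s'1 t'0 t'1 ss' tt'].
  by rewrite divr_gt0// lt_min d10.
have vd1 : v * N < d1 by move: vd; rewrite ltr_pdivlMr// lt_min => /andP[].
have vd2 : v * N < d2 by move: vd; rewrite ltr_pdivlMr// lt_min => /andP[].
have hN : `|h| <= N by rewrite /N -addrA lerDl addr_ge0.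
have kN : `|k| <= N by rewrite /N -addrA addrCA lerDl addr_ge0.
pose X b := a + (s' + b * v) * h; pose Y b := c + (t' + b * v) * k.
have hX b : 0 <= b <= 1 -> `|X b - x| <= v * `|h|.
  move=> b01; have -> : X b - x = (s' + b * v - s) * h by rewrite /X /x; ring.
  by rewrite normrM ler_wpM2r// ler_norml; apply/andP; split; nra.
have hY b : 0 <= b <= 1 -> `|Y b - y| <= v * `|k|.
  move=> b01; have -> : Y b - y = (t' + b * v - t) * k by rewrite /Y /y; ring.
  by rewrite normrM ler_wpM2r// ler_norml; apply/andP; split; nra.
have in01 b u : 0 <= b <= 1 -> 0 <= u -> u + v <= 1 -> 0 <= u + b * v <= 1.
  by move=> *; apply/andP; split; nra.
have b0 : 0 <= (0 : R) <= 1 by rewrite lexx ler01.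
have b1 : 0 <= (1 : R) <= 1 by rewrite lexx ler01.
have close f D1 D2 b (d := e / (4 * N ^+ 2)) : 0 <= b <= 1 ->
    (forall s0 t0, `|s0| <= v * N -> `|t0| <= v * N ->
    `|f (x + s0) (y + t0) - f x y - (D1 * s0 + D2 * t0)| <= d * (`|s0| + `|t0|)) ->
    forall b', 0 <= b' <= 1 ->
    `|f (X b) (Y b') - f x y - (D1 * (X b - x) + D2 * (Y b' - y))| <= d * (v * N).
  move=> hb df b' hb'; have hv0 := ltW v0.
  have := df (X b - x) (Y b' - y); rewrite !subrKC.
  have vh : v * `|h| <= v * N by rewrite ler_wpM2l.
  have vk : v * `|k| <= v * N by rewrite ler_wpM2l.
  move=> /(_ (le_trans (hX _ hb) vh) (le_trans (hY _ hb') vk)) /le_trans; apply.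
  rewrite ler_wpM2l ?(ltW e'0)//; apply: (le_trans (lerD (hX _ hb) (hY _ hb'))).
  by rewrite -mulrDr ler_wpM2l// /N lerDl.
have {}dp b b' : 0 <= b <= 1 -> 0 <= b' <= 1 -> _ := fun hb hb' =>
  @close p A B b hb (fun s0 t0 hs ht =>
    dp s0 t0 (le_lt_trans hs vd1) (le_lt_trans ht vd1)) b' hb'.
have {}dq b b' : 0 <= b <= 1 -> 0 <= b' <= 1 -> _ := fun hb hb' =>
  @close q B C b hb (fun s0 t0 hs ht =>
    dq s0 t0 (le_lt_trans hs vd2) (le_lt_trans ht vd2)) b' hb'.
(* The mean value theorem is applied to the difference of [P] along the two horizontal sides, so
   that one abscissa [X b] serves both and only values of [p] remain. The vertical sides are treated
   in the same way. *)
have [b hb eP] : exists2 b, 0 <= b <= 1 &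
   (P (X 1) (Y 1) - P (X 1) (Y 0)) - (P (X 0) (Y 1) - P (X 0) (Y 0)) =
   (p (X b) (Y 1) - p (X b) (Y 0)) * (v * h).
  have [b hb|b hb eqb] := @has_deriv_MVT R (fun t => P t (Y 1) - P t (Y 0))
    (fun t => p t (Y 1) - p t (Y 0)) (X 0) (v * h); last first.
    have X1 : X 0 + v * h = X 1 by rewrite /X; ring.
    have Xb : X 0 + b * (v * h) = X b by rewrite /X; ring.
    by exists b => //; rewrite -Xb -eqb X1.
  have -> : X 0 + b * (v * h) = X b by rewrite /X; ring.
  have [d _ _] := H _ _ (in01 _ _ hb s'0 s'1) (in01 _ _ b1 t'0 t'1).
  have [d' _ _] := H _ _ (in01 _ _ hb s'0 s'1) (in01 _ _ b0 t'0 t'1).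
  exact: has_derivB d d'.
have [b' hb' eQ] : exists2 b, 0 <= b <= 1 &
   (Q (X 1) (Y 1) - Q (X 0) (Y 1)) - (Q (X 1) (Y 0) - Q (X 0) (Y 0)) =
   (q (X 1) (Y b) - q (X 0) (Y b)) * (v * k).
  have [b' hb'|b' hb' eqb] := @has_deriv_MVT R (fun t => Q (X 1) t - Q (X 0) t)
    (fun t => q (X 1) t - q (X 0) t) (Y 0) (v * k); last first.
    have Y1 : Y 0 + v * k = Y 1 by rewrite /Y; ring.
    have Yb : Y 0 + b' * (v * k) = Y b' by rewrite /Y; ring.
    by exists b' => //; rewrite -Yb -eqb Y1.
  have -> : Y 0 + b' * (v * k) = Y b' by rewrite /Y; ring.
  have [_ d _] := H _ _ (in01 _ _ b1 s'0 s'1) (in01 _ _ hb' t'0 t'1).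
  have [_ d' _] := H _ _ (in01 _ _ b0 s'0 s'1) (in01 _ _ hb' t'0 t'1).
  exact: has_derivB d d'.
have := dp _ _ hb b1; have := dp _ _ hb b0.
have := dq _ _ b1 hb'; have := dq _ _ b0 hb'.
set q0 := q (X 0) _ - _ - _; set q1 := q (X 1) _ - _ - _.
set p0 := p _ (Y 0) - _ - _; set p1 := p _ (Y 1) - _ - _.
move=> hq0 hq1 hp0 hp1.
have X0 : a + s' * h = X 0 by rewrite /X mul0r addr0.
have Y0 : c + t' * k = Y 0 by rewrite /Y mul0r addr0.
have X1 : a + (s' + v) * h = X 1 by rewrite /X mul1r.
have Y1 : c + (t' + v) * k = Y 1 by rewrite /Y mul1r.
rewrite X0 Y0 X1 Y1.
(* The linear parts cancel because the [y]-derivative of [p] and the [x]-derivative of [q] are the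
   same number [B]. *)
have -> : Q (X 1) (Y 1) - P (X 1) (Y 1) - (Q (X 0) (Y 1) - P (X 0) (Y 1)) -
   (Q (X 1) (Y 0) - P (X 1) (Y 0)) + (Q (X 0) (Y 0) - P (X 0) (Y 0)) =
   (q1 - q0) * (v * k) - (p1 - p0) * (v * h).
  transitivity ((q (X 1) (Y b') - q (X 0) (Y b')) * (v * k) -
     (p (X b) (Y 1) - p (X b) (Y 0)) * (v * h)); first by rewrite -eQ -eP; ring.
  by rewrite /q1 /q0 /p1 /p0 -X0 -X1 -Y0 -Y1; ring.
set D := e / _ * _ in hq0 hq1 hp0 hp1.
have vk : `|v * k| <= v * N by rewrite normrM gtr0_norm// ler_wpM2l// ltW.
have vh : `|v * h| <= v * N by rewrite normrM gtr0_norm// ler_wpM2l// ltW.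
have -> : e * v ^+ 2 = (D + D) * (v * N) + (D + D) * (v * N).
  by rewrite /D; field; rewrite gt_eqF.
apply: (le_trans (ler_normB _ _)); rewrite !normrM; apply: lerD.
  apply: ler_pM => //; rewrite -?normrM//.
  exact: le_trans (ler_normB _ _) (lerD _ _).
apply: ler_pM => //; rewrite -?normrM//.
exact: le_trans (ler_normB _ _) (lerD _ _).
Qed.

End Goursat.

(** * Potentials of closed differential forms on a disc *)

Section Potential.
Variable R : realType.
Implicit Types (p q F : R -> R -> R).

Definition plane_disc (r x y : R) := x ^+ 2 + y ^+ 2 < r ^+ 2.

Lemma has_grad_slice1 p x y A B : has_grad p x y A B -> has_deriv (p ^~ y) x A.
Proof.
move=> h e e0; have [d d0 {}h] := h _ e0; exists d => // s sd.
by have := h s 0 sd; rewrite normr0 mulr0 !addr0; exact.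
Qed.

Lemma has_grad_slice2 p x y A B : has_grad p x y A B -> has_deriv (p x) y B.
Proof.
move=> h e e0; have [d d0 {}h] := h _ e0; exists d => // s sd.
by have := h 0 s; rewrite normr0 mulr0 addr0 !add0r; apply.
Qed.

Lemma has_grad_continuous p x y A B : has_grad p x y A B -> forall e, 0 < e ->
  exists2 d, 0 < d & forall s t, `|s| < d -> `|t| < d ->
    `|p (x + s) (y + t) - p x y| <= e.
Proof.
move=> h e e0; have [d d0 {}h] := h _ (@ltr01 R).
pose N := 2 * (`|A| + `|B| + 2).
have N0 : 0 < N by rewrite mulr_gt0// ltr_wpDl// addr_ge0.
exists (Num.min d (e / N)) => [|s t]; first by rewrite lt_min d0 divr_gt0.
rewrite !lt_min => /andP[sd se] /andP[td te].
have -> : p (x + s) (y + t) - p x y =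
  (p (x + s) (y + t) - p x y - (A * s + B * t)) + (A * s + B * t) by ring.
apply: (le_trans (ler_normD _ _)).
have := h _ _ sd td; have := ler_normD (A * s) (B * t); rewrite !normrM.
have sA : `|A| * `|s| <= `|A| * (e / N) by rewrite ler_wpM2l// ltW.
have tB : `|B| * `|t| <= `|B| * (e / N) by rewrite ler_wpM2l// ltW.
have : (`|A| + `|B| + 2) * (e / N) = e / 2.
  by rewrite /N; field; rewrite gt_eqF// ltr_wpDl// addr_ge0.
by lra.
Qed.

Lemma plane_disc_open r x y : plane_disc r x y -> exists2 d, 0 < d &
  forall s t, `|s| < d -> `|t| < d -> plane_disc r (x + s) (y + t).
Proof.
rewrite /plane_disc => xyr.
have sq (a b : R) : has_grad (fun a b => a ^+ 2 + b ^+ 2) a b (2 * a) (2 * b).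
  move=> e e0; exists e => // s t se te.
  have -> : (a + s) ^+ 2 + (b + t) ^+ 2 - (a ^+ 2 + b ^+ 2) -
    (2 * a * s + 2 * b * t) = s * s + t * t by ring.
  apply: (le_trans (ler_normD _ _)); rewrite !normrM mulrDr.
  by apply: lerD; rewrite ler_wpM2r// ltW.
have e0 : 0 < (r ^+ 2 - (x ^+ 2 + y ^+ 2)) / 2 by lra.
have [d d0 h] := has_grad_continuous (sq x y) e0.
by exists d => // s t sd td; have := h _ _ sd td; rewrite ler_norml => /andP[]; lra.
Qed.

(** Move first in [y], then in [x], or conversely: on each leg the mean value theorem gives a value
    of a partial derivative, which is close to its value at [(x, y)] by continuity there. *)
Lemma has_grad_of_partials F p q x y r : 0 < r ->
  (forall s t, `|s| < r -> `|t| < r ->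
    has_deriv (F ^~ (y + t)) (x + s) (p (x + s) (y + t)) /\
    has_deriv (F (x + s)) (y + t) (q (x + s) (y + t))) ->
  (forall e, 0 < e -> exists2 d, 0 < d & forall s t, `|s| < d -> `|t| < d ->
    `|p (x + s) (y + t) - p x y| <= e /\ `|q (x + s) (y + t) - q x y| <= e) ->
  has_grad F x y (p x y) (q x y).
Proof.
move=> r0 hF hpq e e0; have [d d0 {}hpq] := hpq _ e0.
exists (Num.min d r) => [|s t]; first by rewrite lt_min d0.
rewrite !lt_min => /andP[sd sr] /andP[td tr].
have scale (a : R) u b : 0 <= a <= 1 -> `|u| < b -> `|a * u| < b.
  move=> /andP[a0 a1]; apply: le_lt_trans.
  by rewrite normrM ger0_norm// ler_piMl.
have n0 b (u : R) : `|u| < b -> `|0 : R| < b.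
  by rewrite normr0; apply: le_lt_trans.
have [a a01 eqs] := @has_deriv_MVT R (F ^~ y) (p ^~ y) x s (fun a a01 =>
  (eq_ind _ (fun z => has_deriv (F^~ z) (x + a * s) (p (x + a * s) z))
    (hF (a * s) 0 (scale _ _ _ a01 sr) (n0 _ _ tr)).1 _ (addr0 y))).
have [b b01 eqt] := @has_deriv_MVT R (F (x + s)) (q (x + s)) y t (fun b b01 =>
  (hF s (b * t) sr (scale _ _ _ b01 tr)).2).
have -> : F (x + s) (y + t) - F x y - (p x y * s + q x y * t) =
  (p (x + a * s) y - p x y) * s + (q (x + s) (y + b * t) - q x y) * t.
  rewrite !mulrBl -eqs -eqt; ring.
apply: (le_trans (ler_normD _ _)); rewrite !normrM mulrDr; apply: lerD.
  rewrite ler_wpM2r//.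
  by have [] := hpq (a * s) 0 (scale _ _ _ a01 sd) (n0 _ _ td); rewrite addr0.
by rewrite ler_wpM2r//; have [] := hpq s (b * t) sd (scale _ _ _ b01 td).
Qed.

(** A disc centred at the origin contains the rectangle spanned by the origin and any of its points,
    so Goursat's lemma applies to that rectangle. *)
Lemma plane_disc_scale r x y s t : 0 <= s <= 1 -> 0 <= t <= 1 -> plane_disc r x y ->
  plane_disc r (s * x) (t * y).
Proof.
have sq (a b : R) : 0 <= a <= 1 -> (a * b) ^+ 2 <= b ^+ 2.
  by move=> /andP[a0 a1]; rewrite exprMn ler_piMl ?sqr_ge0// expr_le1.
by move=> s01 t01; apply: le_lt_trans; apply: lerD; exact: sq.
Qed.

(** The form [p dx + q dy] is closed since the cross derivatives agree. Integrate [p] along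
    horizontal chords to get [P] and [q] along vertical ones to get [Q]; by Goursat's lemma [Q - P]
    splits into a function of [x] and a function of [y], and the latter corrects [P]. The loss from
    [r] to [r'] makes the integrands continuous on closed chords. *)
Lemma potential_exists p q r r' : r' < r -> 0 < r' ->
  (forall x y, plane_disc r x y ->
    exists A B C, has_grad p x y A B /\ has_grad q x y B C) ->
  exists F, forall x y, plane_disc r' x y -> has_grad F x y (p x y) (q x y).
Proof.
move=> r'r r'0 hpq.
have wide x y : x ^+ 2 + y ^+ 2 <= r' ^+ 2 -> plane_disc r x y.
  move=> /le_lt_trans; apply; rewrite ltrXn2r//; exact: ltW.
have primitive (g : R -> R) y :
    (forall x, x ^+ 2 + y ^+ 2 <= r' ^+ 2 -> {for x, continuous g}) ->
    exists G, forall x, plane_disc r' x y -> has_deriv G x (g x).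
  move=> gc; have [yr|yr] := ltrP (y ^+ 2) (r' ^+ 2); last first.
    by exists g => x; rewrite /plane_disc => xy; have := sqr_ge0 x; lra.
  have m2 : 0 <= r' ^+ 2 - y ^+ 2 by rewrite subr_ge0 ltW.
  have [x|G hG] := @primitive_exists R g (Num.sqrt (r' ^+ 2 - y ^+ 2)).
    by rewrite -sqrtr_sqr ler_sqrt// lerBrDr => /gc.
  exists G => x; rewrite /plane_disc => xy; apply: hG.
  by rewrite -sqrtr_sqr ltr_sqrt ?subr_gt0 // ltrBrDr.
have /choice[P hP] y : exists G, forall x, plane_disc r' x y -> has_deriv G x (p x y).
  apply: primitive => x /wide /hpq[A [B [C [/has_grad_slice1 + _]]]].
  exact: has_deriv_continuous.
have /choice[Q hQ] x : exists G, forall y, plane_disc r' x y -> has_deriv G y (q x y).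
  have [|G hG] := primitive (q x) x.
    move=> y; rewrite addrC => /wide /hpq[A [B [C [_ /has_grad_slice2]]]].
    exact: has_deriv_continuous.
  by exists G => y; rewrite /plane_disc addrC => /hG.
pose D x y := Q x y - P y x.
have splitD x y : plane_disc r' x y -> D x y = D x 0 + (D 0 y - D 0 0).
  move=> xy; have := @goursat_rectangle R p q (fun x y => P y x) Q 0 0 x y.
  rewrite /mixed_diff !add0r -/(D _ _) -/(D _ _) => H.
  suff : D x y - D 0 y - D x 0 + D 0 0 = 0 by lra.
  apply: H => s t s01 t01 /=; rewrite !add0r.
  have d' := plane_disc_scale s01 t01 xy.
  by split; [exact: hP|exact: hQ|apply/hpq/wide/ltW].
(* By [splitD] this equals [Q x y - D x 0] on the disc: the first form is differentiated in [x], the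
   second in [y]. *)
exists (fun x y => P y x + (D 0 y - D 0 0)) => x y xy.
have [d d0 hd] := plane_disc_open xy.
apply: (@has_grad_of_partials _ p q x y d) => //.
  move=> s t sd td; have xyst := hd _ _ sd td; split.
    have := hP _ _ xyst => h e /h[d' d'0 {}h]; exists d' => // s' /h.
    by congr (`| _ - _ | <= _); ring.
  have [d' d'0 hd'] := plane_disc_open xyst.
  have := hQ _ _ xyst => h.
  apply: (@has_deriv_ext _ (fun t => Q (x + s) t - D (x + s) 0) _ _ _ d' d'0).
    move=> u ud'.
    have := hd' 0 u; rewrite normr0 addr0 => /(_ d'0 ud') /splitD.
    by rewrite /D; lra.
  move=> e /h[d2 d20 {}h]; exists d2 => // s' /h.
  by congr (`| _ - _ | <= _); ring.
have [A [B [C [dp dq]]]] := hpq _ _ (wide _ _ (ltW xy)).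
move=> e e0; have [d1 d10 {}dp] := has_grad_continuous dp e0.
have [d2 d20 {}dq] := has_grad_continuous dq e0.
exists (Num.min d1 d2) => [|s t]; first by rewrite lt_min d10.
by rewrite !lt_min => /andP[? ?] /andP[? ?]; split; [exact: dp|exact: dq].
Qed.

End Potential.

(** * Smoothing of holomorphic functions *)

Section UniformContinuity.
Variables (K : numFieldType) (V : pseudoMetricType K) (R : realType).

(** Only the first point is confined to the compact set; the second ranges over [W]. The radii live
    in [K], which may be [R[i]], while the values of [f] are in [R]. *)
Lemma compact_uniform_continuous (A W : set V) (f : V -> R) :
  compact A -> A `<=` W -> {within W, continuous f} ->
  forall e, 0 < e -> exists2 d : K, 0 < d &
    forall x y, A x -> W y -> ball x d y -> `|f y - f x| <= e.
Proof.
move=> /compact_near_coveringP cA AW /subspace_continuousP cf e e0.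
have [|d [d0 hd]] := @filter_ex _ ((0 : K)^'+) _ (fun d => 0 < d /\
    A `<=` [set x | forall y, W x -> W y -> ball x d y -> `|f y - f x| <= e]);
  last by exists d => // x y Ax; apply: hd => //; exact: AW.
have nd0 : \forall d \near (0 : K)^'+, 0 < d by exact: nbhs_right_gt.
apply: filterI => //.
apply: (cA K ((0 : K)^'+) 
  (fun d x => forall y, W x -> W y -> ball x d y -> `|f y - f x| <= e)) => x Ax.
have e2 : 0 < e / 2 by rewrite divr_gt0.
have /cvgrPdist_le/(_ _ e2) := cf _ (AW _ Ax).
rewrite near_withinE => /nbhs_ballP[d /= d0 hd].
have d2 : 0 < d / 2 by rewrite divr_gt0.
near=> x' r => y Wx' Wy x'y.
have xx' : ball x (d / 2) x' by near: x'; exact: nbhsx_ballx.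
have rd : r <= d / 2 by near: r; apply: nbhs_right_le.
have xy : ball x d y.
  rewrite [d]splitr; apply: ball_triangle xx' _; exact: (le_ball rd).
have h1 := hd _ xy Wy.
have h2 : `|f x - f x'| <= e / 2.
  by apply: hd Wx'; apply: le_ball xx'; rewrite ler_pdivrMr// ler_peMr ?ler1n ?(ltW d0).
have -> : f y - f x' = - (f x - f y) + (f x - f x') by ring.
by apply: (le_trans (ler_normD _ _)); rewrite normrN; lra.
Unshelve. all: by end_near. Qed.

Lemma compact_open_enlargement (A U : set V) :
  compact A -> open U -> A `<=` U ->
  exists2 d : K, 0 < d & forall x y, A x -> ball x d y -> U y.
Proof.
move=> /compact_near_coveringP cA; rewrite openE => oU AU.
have [|d [d0 hd]] := @filter_ex _ ((0 : K)^'+) _ (fun d => 0 < d /\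
    A `<=` [set x | forall y, ball x d y -> U y]);
  last by exists d => // x y Ax; exact: hd.
have nd0 : \forall d \near (0 : K)^'+, 0 < d by exact: nbhs_right_gt.
apply: filterI => //.
apply: (cA K ((0 : K)^'+) (fun d x => forall y, ball x d y -> U y)) => x Ax.
have /nbhs_ballP[d /= d0 hd] := oU _ (AU _ Ax).
have d2 : 0 < d / 2 by rewrite divr_gt0.
near=> x' r => y x'y; apply: hd.
have xx' : ball x (d / 2) x' by near: x'; exact: nbhsx_ballx.
have rd : r <= d / 2 by near: r; apply: nbhs_right_le.
rewrite [d]splitr; apply: ball_triangle xx' _; exact: (le_ball rd).
Unshelve. all: by end_near. Qed.

End UniformContinuity.

Section Smoothing.
Variable R : realType.
Implicit Types (p q : R -> R -> R) (r h e c x y s t a b A B : R).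

(* [p + iq] has the complex derivative [a + ib] at [x + iy]. *)
Definition hol_pair p q x y a b := has_grad p x y a (- b) /\ has_grad q x y b a.

Lemma plane_disc_compact (r : R) :
  compact [set z : R * R | z.1 ^+ 2 + z.2 ^+ 2 <= r ^+ 2].
Proof.
apply: (@subclosed_compact _ _ (`[- `|r|, `|r|] `*` `[- `|r|, `|r|])).
- apply: (@closed_comp _ _ (fun z : R * R => z.1 ^+ 2 + z.2 ^+ 2) [set x | x <= r ^+ 2]).
    move=> z _; apply: (@cvgD _ R^o); apply: (@continuous_comp _ _ _ _ (@GRing.exp R ^~ 2%N));
      [exact: cvg_fst|exact: exprn_continuous|exact: cvg_snd|exact: exprn_continuous].
  exact: closed_le.
- by apply: compact_setX; exact: segment_compact.
move=> [a b] /= ab.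
have le u : u ^+ 2 <= r ^+ 2 -> u \in `[- `|r|, `|r|].
  move=> ur; rewrite in_itv /= -ler_norml -(sqrtr_sqr u) -(sqrtr_sqr r).
  exact: ler_wsqrtr.
by split; apply: le; apply: le_trans ab; rewrite ?lerDl ?lerDr sqr_ge0.
Qed.

Lemma has_grad_uniform p r r' e : 0 <= r' -> r' < r -> 0 < e ->
  (forall x y, plane_disc r x y -> exists A B, has_grad p x y A B) ->
  exists2 d, 0 < d & forall x y x' y', plane_disc r' x y -> plane_disc r x' y' ->
    `|x' - x| < d -> `|y' - y| < d -> `|p x' y' - p x y| <= e.
Proof.
move=> r'0 r'r e0 hp.
have [] := @compact_uniform_continuous R (R * R)%type R _
  [set z : R * R | plane_disc r z.1 z.2] (fun z => p z.1 z.2) (@plane_disc_compact r') _ _ e e0.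
- by move=> z /= /le_lt_trans; apply; rewrite ltrXn2r// (le_trans r'0)// ltW.
- apply: continuous_in_subspaceT => -[x y]; rewrite inE => /hp[A [B]].
  move=> /has_grad_continuous h; apply/cvgrPdist_le => d d0.
  have [d' d'0 {}h] := h _ d0.
  have : \forall z \near (x, y), ball (x, y) d' z by exact: nbhsx_ballx.
  apply: filterS => -[x' y'] [/= xx' yy'].
  rewrite distrC; have := h (x' - x) (y' - y); rewrite !subrKC; apply; rewrite distrC.
    exact: xx'.
  exact: yy'.
move=> d d0 hd; exists d => // x y x' y' xy x'y' xx' yy'.
apply: (hd (x, y) (x', y')) => //; first exact: ltW.
by split; rewrite -ball_normE /= distrC.
Qed.

Lemma has_grad_diff_quotient F c h x y A B A' B' :
  has_grad F (x + h) y A B -> has_grad F x y A' B' ->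
  has_grad (fun x y => (F (x + h) y - F x y) * c) x y ((A - A') * c) ((B - B') * c).
Proof.
move=> h1 h2 e e0; have c0 : 0 < `|c| + 1 by rewrite ltr_wpDl.
have e2 : 0 < e / 2 / (`|c| + 1) by rewrite !divr_gt0.
have [d1 d10 {}h1] := h1 _ e2; have [d2 d20 {}h2] := h2 _ e2.
exists (Num.min d1 d2) => [|s t]; first by rewrite lt_min d10.
rewrite !lt_min => /andP[s1 s2] /andP[t1 t2].
move: (h1 _ _ s1 t1) (h2 _ _ s2 t2).
set f1 := _ - _ - _; set f2 := F (x + s) (y + t) - _ - _ => k1 k2.
have -> : (F (x + s + h) (y + t) - F (x + s) (y + t)) * c -
    (F (x + h) y - F x y) * c - ((A - A') * c * s + (B - B') * c * t) =
    (f1 - f2) * c by rewrite /f1 /f2 (addrAC x s h); ring.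
rewrite normrM; apply: (@le_trans _ _ ((`|f1| + `|f2|) * (`|c| + 1))).
  by apply: ler_pM => //; [exact: ler_normB|rewrite lerDl].
set T := `|s| + `|t| in k1 k2 *.
have -> : e * T = (e / 2 / (`|c| + 1) * T + e / 2 / (`|c| + 1) * T) * (`|c| + 1).
  by field; rewrite gt_eqF.
by rewrite ler_pM2r//; exact: lerD.
Qed.

Lemma plane_disc_shift (r h x y : R) : 0 < r -> 0 <= h -> plane_disc r x y ->
  plane_disc (r + h) (x + h) y.
Proof.
rewrite /plane_disc => r0 h0 xyr.
have xr : x < r.
  rewrite ltNge; apply/negP => rx; have := sqr_ge0 y.
  by have : r * r <= x * x by [apply: ler_pM => //; exact: ltW]; lra.
by nra.
Qed.

(* [p1 + i q1] is the difference quotient with step [h] of a primitive of [p + iq]. *)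
Lemma average_hol p q r r' e : 0 < r' -> r' < r -> 0 < e ->
  (forall x y, plane_disc r x y -> exists a b, hol_pair p q x y a b) ->
  exists h p1 q1, [/\ 0 < h, (forall x y, plane_disc r' x y -> plane_disc r (x + h) y) &
    forall x y, plane_disc r' x y -> [/\ `|p1 x y - p x y| <= e, `|q1 x y - q x y| <= e &
      hol_pair p1 q1 x y ((p (x + h) y - p x y) / h) ((q (x + h) y - q x y) / h)]].
Proof.
move=> r'0 r'r e0 hpq; pose r1 := (r + r') / 2.
have [r'r1 r1r] : r' < r1 /\ r1 < r by rewrite /r1; split; lra.
have r10 := lt_trans r'0 r'r1.
(* [F + iG] is a primitive of [p + iq]: the forms [p dx - q dy] and [q dx + p dy] are closed by the
   Cauchy-Riemann equations. *)
have [F hF] : exists F, forall x y, plane_disc r1 x y -> has_grad F x y (p x y) (- q x y).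
  apply: (@potential_exists R p (fun x y => - q x y) r r1) => // x y /hpq[a [b [dp dq]]].
  exists a, (- b), (- a); split => // d /dq[d' d'0 h]; exists d' => // s t sd td.
  by rewrite -normrN; have := h s t sd td; congr (`| _ | <= _); ring.
have [G hG] : exists G, forall x y, plane_disc r1 x y -> has_grad G x y (q x y) (p x y).
  apply: (@potential_exists R q p r r1) => // x y /hpq[a [b [dp dq]]].
  by exists b, a, (- b).
have [d1 d10 {}hp] := @has_grad_uniform p r r1 e (ltW r10) r1r e0 (fun x y xy =>
  let: ex_intro a (ex_intro b (conj dp dq)) := hpq x y xy in
  ex_intro _ a (ex_intro _ _ dp)).
have [d2 d20 {}hq] := @has_grad_uniform q r r1 e (ltW r10) r1r e0 (fun x y xy =>
  let: ex_intro a (ex_intro b (conj dp dq)) := hpq x y xy in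
  ex_intro _ b (ex_intro _ _ dq)).
(* The step lies below both moduli of uniform continuity and below the gap [r1 - r'], so shifted
   points stay where [F] and [G] are primitives. *)
pose h := Num.min (Num.min d1 d2) (r1 - r') / 2.
have h0 : 0 < h by rewrite divr_gt0// !lt_min d10 d20 subr_gt0.
have hm : h < Num.min (Num.min d1 d2) (r1 - r').
  by rewrite /h; move: h0; rewrite /h; lra.
clearbody h; move: hm; rewrite !lt_min => /andP[/andP[hd1 hd2] hr].
have sub (x y a b : R) : 0 <= a -> a <= b -> plane_disc a x y -> plane_disc b x y.
  by move=> a0 ab /lt_le_trans; apply; rewrite lerXn2r// nnegrE (le_trans a0).
have shift x y t : 0 <= t <= 1 -> plane_disc r' x y -> plane_disc r1 (x + t * h) y.
  move=> /andP[t0 t1] xy; have th : 0 <= t * h by rewrite mulr_ge0// ltW.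
  apply: (@sub _ _ (r' + t * h)); [by rewrite addr_ge0// ltW| |exact: plane_disc_shift].
  by rewrite -lerBrDl (le_trans _ (ltW hr))// ler_piMl// ltW.
exists h, (fun x y => (F (x + h) y - F x y) / h), (fun x y => (G (x + h) y - G x y) / h).
have i1 : 0 <= (1 : R) <= 1 by rewrite ler01 lexx.
have i0 : 0 <= (0 : R) <= 1 by rewrite ler01 lexx.
split=> // [x y xy|x y xy].
  by apply: (@sub _ _ r1) => //; rewrite ?ltW//; have := shift x y 1 i1 xy; rewrite mul1r.
have xy1 : plane_disc r1 x y by have := shift x y 0 i0 xy; rewrite mul0r addr0.
have xyh : plane_disc r1 (x + h) y by have := shift x y 1 i1 xy; rewrite mul1r.
(* By the mean value theorem the quotient is a value of [f] at [x + t * h], and uniform continuity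
   compares it with the value at [x]. *)
have close f H d : 0 < d -> h < d ->
    (forall x y x' y', plane_disc r1 x y -> plane_disc r x' y' ->
      `|x' - x| < d -> `|y' - y| < d -> `|f x' y' - f x y| <= e) ->
    (forall x y, plane_disc r1 x y -> has_deriv (H ^~ y) x (f x y)) ->
    `|(H (x + h) y - H x y) / h - f x y| <= e.
  move=> d0 hd hf dH.
  have [t t01 ->] := @has_deriv_MVT R (H ^~ y) (f ^~ y) x h
    (fun t t01 => dH _ _ (shift _ _ _ t01 xy)).
  rewrite mulfK ?gt_eqF//; apply: hf => //.
  - by apply: (@sub _ _ r1); rewrite ?ltW//; exact: shift.
  - have -> : x + t * h - x = t * h by ring.
    move: t01 => /andP[t0 t1]; rewrite (@ger0_norm R) ?mulr_ge0 ?(ltW h0)//.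
    by apply: le_lt_trans hd; rewrite ler_piMl// ltW.
  - by rewrite subrr (@normr0 _ R).
split.
- by apply: (close p F d1) => // ? ? /hF/has_grad_slice1.
- by apply: (close q G d2) => // ? ? /hG/has_grad_slice1.
split; last exact: has_grad_diff_quotient (hG _ _ xyh) (hG _ _ xy1).
have := has_grad_diff_quotient h^-1 (hF _ _ xyh) (hF _ _ xy1).
by congr (has_grad _ _ _ _ _); ring.
Qed.

Lemma has_grad_line p x y s t c A B : has_grad p (x + c * s) (y + c * t) A B ->
  has_deriv (fun c => p (x + c * s) (y + c * t)) c (A * s + B * t).
Proof.
move=> h e e0; set N := `|s| + `|t| + 1.
have N0 : 0 < N by rewrite ltr_wpDl// addr_ge0.
have [d d0 {}h] := h _ (divr_gt0 e0 N0).
exists (d / N) => [|u]; first exact: divr_gt0.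
rewrite ltr_pdivlMr// => ud.
have us : `|u * s| < d.
  by apply: le_lt_trans ud; rewrite normrM ler_wpM2l// /N -addrA lerDl addr_ge0.
have ut : `|u * t| < d.
  by apply: le_lt_trans ud; rewrite normrM ler_wpM2l// /N -addrA addrCA lerDl addr_ge0.
have := h _ _ us ut.
rewrite -!addrA -!mulrDl !addrA => H.
have -> : (A * s + B * t) * u = A * (u * s) + B * (u * t) by ring.
apply: (le_trans H); rewrite !normrM -mulrDr -mulrA ler_wpM2l ?(ltW e0)//.
by rewrite mulrCA ler_piMr// mulrC ler_pdivrMr// mul1r /N lerDl.
Qed.

(** Here [p] is the real part of a function with complex derivative [pa + i pb] near the point and
    second derivative [A + iB] at the point, and the quadratic term is the real part of
    [(A + iB)(s + it)^2 / 2]. Subtract the polynomial along the segment and apply the mean value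
    theorem: what is left are the first-order remainders of [pa] and [pb], multiplied by [s] and
    [t]. *)
Lemma taylor2 p pa pb x y A B r : 0 < r ->
  (forall s t, `|s| < r -> `|t| < r ->
    has_grad p (x + s) (y + t) (pa (x + s) (y + t)) (- pb (x + s) (y + t))) ->
  has_grad pa x y A (- B) -> has_grad pb x y B A ->
  forall e, 0 < e -> exists2 d, 0 < d & forall s t, `|s| < d -> `|t| < d ->
    `|p (x + s) (y + t) - p x y - (pa x y * s - pb x y * t) -
      (A * (s ^+ 2 - t ^+ 2) / 2 - B * (s * t))| <= e * (s ^+ 2 + t ^+ 2).
Proof.
move=> r0 hp dpa dpb e e0; have e2 : 0 < e / 2 by rewrite divr_gt0.
have [d1 d10 {}dpa] := dpa _ e2; have [d2 d20 {}dpb] := dpb _ e2.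
exists (Num.min r (Num.min d1 d2)) => [|s t]; first by rewrite !lt_min r0 d10.
rewrite !lt_min => /andP[sr /andP[sd1 sd2]] /andP[tr /andP[td1 td2]].
set L := pa x y * s - _; set Q := A * _ / 2 - _.
have scale (c u b : R) : 0 <= c <= 1 -> `|u| < b -> `|c * u| < b.
  by move=> /andP[c0 c1]; apply: le_lt_trans; rewrite normrM ger0_norm// ler_piMl.
pose dg c := pa (x + c * s) (y + c * t) * s + (- pb (x + c * s) (y + c * t)) * t.
have quad c : has_deriv (fun c => c * L + c ^+ 2 * Q) c (L + 2 * c * Q).
  move=> k k0; have Q0 : 0 < `|Q| + 1 by rewrite ltr_wpDl.
  exists (k / (`|Q| + 1)) => [|u]; first exact: divr_gt0.
  rewrite ltr_pdivlMr// => uk.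
  have -> : (c + u) * L + (c + u) ^+ 2 * Q - (c * L + c ^+ 2 * Q) -
    (L + 2 * c * Q) * u = u * Q * u by ring.
  rewrite normrM ler_wpM2r// normrM (le_trans _ (ltW uk))//.
  by rewrite ler_wpM2l// lerDl.
have [c /[dup] c01 /andP[c0 c1]] := @has_deriv_MVT01 R
  (fun c => p (x + c * s) (y + c * t) - (c * L + c ^+ 2 * Q))
  (fun c => dg c - (L + 2 * c * Q))
  (fun c c01 => has_derivB (has_grad_line (hp _ _ (scale _ _ _ c01 sr) (scale _ _ _ c01 tr)))
    (quad c)).
rewrite !mul1r !mul0r !addr0 expr1n expr0n /= mul1r mul0r addr0 subr0 => eqg.
have -> : p (x + s) (y + t) - p x y - L - Q =
  p (x + s) (y + t) - (L + Q) - p x y by ring.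
rewrite eqg.
have := dpa _ _ (scale _ _ _ c01 sd1) (scale _ _ _ c01 td1).
have := dpb _ _ (scale _ _ _ c01 sd2) (scale _ _ _ c01 td2).
set eb := _ - _ - (B * _ + _); set ea := _ - _ - (A * _ + _) => hb ha.
have -> : dg c - (L + 2 * c * Q) = ea * s - eb * t.
  by rewrite /dg /L /Q /ea /eb; field.
pose T := `|s| + `|t|.
have hT : e / 2 * (`|c * s| + `|c * t|) <= e / 2 * T.
  rewrite ler_wpM2l ?(ltW e2)// /T !normrM (ger0_norm c0).
  by apply: lerD; rewrite ler_piMl.
have {}ha := le_trans ha hT; have {}hb := le_trans hb hT.
apply: (le_trans (ler_normB _ _)); rewrite !normrM.
apply: (@le_trans _ _ (e / 2 * T * T)).
  by rewrite [leRHS]mulrDr; apply: lerD; rewrite ler_wpM2r.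
rewrite -(real_normK (num_real s)) -(real_normK (num_real t)) -mulrA.
rewrite [leRHS](_ : _ = e / 2 * (2 * (`|s| ^+ 2 + `|t| ^+ 2))); last by field.
rewrite ler_wpM2l ?(ltW e2)// /T -subr_ge0.
have := sqr_ge0 (`|s| - `|t|); congr (0 <= _); ring.
Qed.

(** Two averages, each costing [e / 2]. The derivative of the second is a difference quotient of the
    first, hence is itself complex differentiable, as [taylor2] demands. *)
Lemma hol_approximation p q r r' e : 0 < r' -> r' < r -> 0 < e ->
  (forall x y, plane_disc r x y -> exists a b, hol_pair p q x y a b) ->
  exists p2 q2, forall x y, plane_disc r' x y ->
    [/\ `|p2 x y - p x y| <= e, `|q2 x y - q x y| <= e &
    exists a b A B, forall k, 0 < k -> exists2 d, 0 < d &
    forall s t, `|s| < d -> `|t| < d ->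
      `|p2 (x + s) (y + t) - p2 x y - (a * s - b * t) -
        (A * (s ^+ 2 - t ^+ 2) - B * (2 * s * t))| <= k * (s ^+ 2 + t ^+ 2) /\
      `|q2 (x + s) (y + t) - q2 x y - (b * s + a * t) -
        (B * (s ^+ 2 - t ^+ 2) + A * (2 * s * t))| <= k * (s ^+ 2 + t ^+ 2)].
Proof.
move=> r'0 r'r e0 hpq; pose r1 := (r + r') / 2.
have [r'r1 r1r] : r' < r1 /\ r1 < r by rewrite /r1; split; lra.
have e2 : 0 < e / 2 by rewrite divr_gt0.
have [h1 [p1 [q1 [h10 _ H1]]]] := average_hol (lt_trans r'0 r'r1) r1r e2 hpq.
have [|h2 [p2 [q2 [h20 sh2 H2]]]] := @average_hol p1 q1 r1 r' _ r'0 r'r1 e2.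
  by move=> x y /H1[_ _ h]; eexists; eexists; exact: h.
have sub x y : plane_disc r' x y -> plane_disc r1 x y.
  by move=> /lt_trans; apply; rewrite ltrXn2r// ltW// (lt_trans r'0).
exists p2, q2 => x y xy.
have [u1 v1 _] := H1 _ _ (sub _ _ xy); have [u2 v2 _] := H2 _ _ xy.
split.
- have -> : p2 x y - p x y = (p2 x y - p1 x y) + (p1 x y - p x y) by ring.
  by apply: (le_trans (ler_normD _ _)); lra.
- have -> : q2 x y - q x y = (q2 x y - q1 x y) + (q1 x y - q x y) by ring.
  by apply: (le_trans (ler_normD _ _)); lra.
pose pa x y := (p1 (x + h2) y - p1 x y) / h2.
pose pb x y := (q1 (x + h2) y - q1 x y) / h2.
have [_ _ [dp1 dq1]] := H1 _ _ (sub _ _ xy).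
have [_ _ [dp1' dq1']] := H1 _ _ (sh2 _ _ xy).
have dpa := has_grad_diff_quotient h2^-1 dp1' dp1.
have dpb := has_grad_diff_quotient h2^-1 dq1' dq1.
set A := (_ - _) / h2 in dpa; set B := (_ - _) / h2 in dpb.
have {}dpa : has_grad pa x y A (- B).
  by move: dpa; congr (has_grad _ _ _ _ _); rewrite /B; ring.
rewrite -/A in dpb.
(* The coefficient of [(s + it)^2] is half the second derivative. *)
exists (pa x y), (pb x y), (A / 2), (B / 2) => k k0.
have [d d0 hd] := plane_disc_open xy.
have [d1 d10 T1] := @taylor2 p2 pa pb x y A B d d0 (fun s t sd td =>
  let: And3 _ _ hh := H2 _ _ (hd s t sd td) in hh.1) dpa dpb _ k0.
have dpa' : has_grad (fun x y => - pa x y) x y (- A) B.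
  move=> c /dpa[d' d'0 hd']; exists d' => // s t sd td.
  by have := hd' _ _ sd td; rewrite -normrN; congr (`|_| <= _); ring.
(* [q2] is the real part of [-i (p2 + i q2)], whose derivative is [pb - i pa]. *)
have [d2 d20 T2] := @taylor2 q2 pb (fun x y => - pa x y) x y B (- A) d d0
  (fun s t sd td => ltac:(by rewrite opprK;
     case: (H2 _ _ (hd s t sd td)) => _ _ []))
  (ltac:(by rewrite opprK)) dpa' _ k0.
exists (Num.min d1 d2) => [|s t]; first by rewrite lt_min d10.
rewrite !lt_min => /andP[s1 s2] /andP[t1 t2]; split.
  by have := T1 _ _ s1 t1; congr (`|_| <= _); field.
by have := T2 _ _ s2 t2; congr (`|_| <= _); field.
Qed.

End Smoothing.

(** * Plurisubharmonic functions on complex lines *)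

Section ComplexPlane.
Variable R : realType.
Local Notation Re := (@complex.Re R).
Local Notation Im := (@complex.Im R).
Implicit Types (z w a b : R[i]) (r : R).

(** The squared modulus as an element of [R], whereas the norm on [R[i]] takes values in [R[i]]; it
    is moreover polynomial in the coordinates. *)
Definition sqn z : R := Re z ^+ 2 + Im z ^+ 2.

Lemma sqn_ge0 z : 0 <= sqn z.
Proof. by rewrite addr_ge0// sqr_ge0. Qed.

Lemma sqnM z w : sqn (z * w) = sqn z * sqn w.
Proof. by case: z w => [a b] [c d]; rewrite /sqn /=; ring. Qed.

Lemma sqnN z : sqn (- z) = sqn z.
Proof. by case: z => a b; rewrite /sqn /= !sqrrN. Qed.

Lemma sqn_real r : sqn r%:C = r ^+ 2.
Proof. by rewrite /sqn /= expr0n /= addr0. Qed.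

Lemma sqn_eq0 z : (sqn z == 0) = (z == 0).
Proof. by rewrite /sqn paddr_eq0 ?sqr_ge0// !sqrf_eq0 eq_complex. Qed.

Lemma normc_sqn z : `|z| = (Num.sqrt (sqn z))%:C.
Proof. by case: z. Qed.

Lemma normc_lt z r : 0 <= r -> (`|z| < r%:C) = (sqn z < r ^+ 2).
Proof.
move=> r0; rewrite normc_sqn ltcR -[r in LHS]ger0_norm// -sqrtr_sqr.
have [z0|z0] := ltrP (sqn z) (r ^+ 2).
  by rewrite ltr_sqrt// (le_lt_trans (sqn_ge0 z)).
by apply/negbTE; rewrite -leNgt ler_wsqrtr.
Qed.

Lemma normc_le z r : 0 <= r -> (`|z| <= r%:C) = (sqn z <= r ^+ 2).
Proof.
move=> r0; rewrite normc_sqn lecR -[r in LHS]ger0_norm// -sqrtr_sqr.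
by rewrite ler_sqrt// sqr_ge0.
Qed.

Lemma normc_eq z r : 0 <= r -> (`|z| = r%:C) <-> (sqn z = r ^+ 2).
Proof.
move=> r0; rewrite normc_sqn; split=> [/complexI <-|->].
  by rewrite sqr_sqrtr// sqn_ge0.
by rewrite sqrtr_sqr ger0_norm.
Qed.

(** Radii of balls over [R[i]] are positive complex numbers, which the order forces to be real. *)
Lemma posc_real (d : R[i]) : 0 < d -> d = (Re d)%:C /\ 0 < Re d.
Proof. by case: d => a b; rewrite ltcE /= => /andP[/eqP -> ?]. Qed.

Lemma Re_le_sqn z r : 0 <= r -> sqn z <= r ^+ 2 -> `|Re z| <= r.
Proof.
move=> r0 zr; rewrite -(ger0_norm r0) -!sqrtr_sqr ler_wsqrtr// (le_trans _ zr)//.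
by rewrite lerDl sqr_ge0.
Qed.

Lemma Im_le_sqn z r : 0 <= r -> sqn z <= r ^+ 2 -> `|Im z| <= r.
Proof.
move=> r0 zr; rewrite -(ger0_norm r0) -!sqrtr_sqr ler_wsqrtr// (le_trans _ zr)//.
by rewrite lerDr sqr_ge0.
Qed.

Lemma near_sqn z r : 0 < r -> \forall w \near z, sqn (w - z) < r.
Proof.
move=> r0; have : \forall w \near z, ball z (Num.sqrt r)%:C w.
  by apply: nbhsx_ballx; rewrite ltcR sqrtr_gt0.
apply: filterS => w; rewrite -ball_normE /= distrC normc_lt ?sqrtr_ge0//.
by rewrite sqr_sqrtr// ltW.
Qed.

Lemma Re_continuous : continuous (Re : R[i] -> R).
Proof.
move=> z; apply/(@cvgrPdist_le _ _ _ (nbhs z)) => e e0.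
move: (near_sqn z (exprn_gt0 2 e0)); apply: filterS => w /ltW /(Re_le_sqn (ltW e0)).
by case: z w => [a b] [c d] /=; rewrite distrC.
Qed.

Lemma Im_continuous : continuous (Im : R[i] -> R).
Proof.
move=> z; apply/(@cvgrPdist_le _ _ _ (nbhs z)) => e e0.
move: (near_sqn z (exprn_gt0 2 e0)); apply: filterS => w /ltW /(Im_le_sqn (ltW e0)).
by case: z w => [a b] [c d] /=; rewrite distrC.
Qed.

Lemma sqn_continuous : continuous sqn.
Proof.
move=> z; have -> : sqn = (fun z => Re z * Re z + Im z * Im z).
  by apply/funext => w; rewrite /sqn !expr2.
apply: (@cvgD _ R^o _ (nbhs z)); apply: (@cvgM _ _ (nbhs z));
  by [exact: Re_continuous|exact: Im_continuous].
Qed.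

(** The harmonic test functions. The family is stable under both partial derivatives, which makes
    [harmonic_on] a computation. *)
Definition quadratic (c : R) a b z : R := c + Re (a * z + b * z ^+ 2).

Lemma quadratic_continuous c a b : continuous (quadratic c a b).
Proof.
move=> z; have -> : quadratic c a b = fun z => c + Re (a * z + b * (z * z)).
  by apply/funext => w; rewrite /quadratic expr2.
have h : (fun z : R[i] => a * z + b * (z * z)) w @[w --> nbhs z] --> a * z + b * (z * z).
  apply: (@cvgD _ _ _ (nbhs z)); apply: (@cvgM _ _ (nbhs z)).
  - exact: cvg_cst.
  - exact: cvg_id.
  - exact: cvg_cst.
  - by apply: (@cvgM _ _ (nbhs z)); exact: cvg_id.
apply: (@cvgD _ R^o _ (nbhs z) _ (fun=> c)); first exact: (@cvg_cst R^o c _ (nbhs z)).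
exact: (cvg_comp _ _ h (@Re_continuous _)).
Qed.

Lemma derive_quadratic (A B C : R) :
  is_derive (0 : R) (1 : R) (fun t : R => A + t * B + t ^+ 2 * C) B.
Proof.
apply: has_deriv_is_derive => e e0; exists (e / (`|C| + 1)) => [|s].
  by rewrite divr_gt0// ltr_wpDl.
rewrite ltr_pdivlMr ?ltr_wpDl// => sC.
have -> : A + (0 + s) * B + (0 + s) ^+ 2 * C - (A + 0 * B + 0 ^+ 2 * C) - B * s =
  s * C * s by ring.
by rewrite normrM ler_wpM2r// normrM (le_trans _ (ltW sC))// ler_wpM2l// lerDl.
Qed.

Lemma along_x_quadratic c a b z : is_derive (0 : R) (1 : R) (along_x (quadratic c a b) z)
  (quadratic (Re a) (2%:R * b) 0 z).
Proof.
have := derive_quadratic (quadratic c a b z) 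
  (quadratic (Re a) (2%:R * b) 0 z) (Re b).
congr is_derive; apply/funext => t; rewrite /along_x /quadratic.
by case: a b z => [a1 a2] [b1 b2] [x y]; rewrite !expr2 /=; ring.
Qed.

Lemma along_y_quadratic c a b z : is_derive (0 : R) (1 : R) (along_y (quadratic c a b) z)
  (quadratic (- Im a) (2%:R * b * 'i) 0 z).
Proof.
have := derive_quadratic (quadratic c a b z)
  (quadratic (- Im a) (2%:R * b * 'i) 0 z) (- Re b).
congr is_derive; apply/funext => t; rewrite /along_y /quadratic.
by case: a b z => [a1 a2] [b1 b2] [x y]; rewrite !expr2 /=; ring.
Qed.

Lemma partial_x_quadratic c a b :
  partial_x (quadratic c a b) = quadratic (Re a) (2%:R * b) 0.
Proof.
apply/funext => z; rewrite /partial_x derive1E.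
exact: (@derive_val _ _ _ _ _ _ _ (along_x_quadratic c a b z)).
Qed.

Lemma partial_y_quadratic c a b :
  partial_y (quadratic c a b) = quadratic (- Im a) (2%:R * b * 'i) 0.
Proof.
apply/funext => z; rewrite /partial_y derive1E.
exact: (@derive_val _ _ _ _ _ _ _ (along_y_quadratic c a b z)).
Qed.

Lemma C1_quadratic V c a b : C1_on V (quadratic c a b).
Proof.
move=> z _; split.
- exact: (@ex_derive _ _ _ _ _ _ _ (along_x_quadratic c a b z)).
- exact: (@ex_derive _ _ _ _ _ _ _ (along_y_quadratic c a b z)).
- by rewrite partial_x_quadratic; exact: quadratic_continuous.
- by rewrite partial_y_quadratic; exact: quadratic_continuous.
Qed.

Lemma harmonic_quadratic V c a b : harmonic_on V (quadratic c a b).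
Proof.
split.
- exact: C1_quadratic.
- by rewrite partial_x_quadratic; exact: C1_quadratic.
- by rewrite partial_y_quadratic; exact: C1_quadratic.
move=> z _; rewrite !(partial_x_quadratic, partial_y_quadratic) /quadratic.
by case: a b z => [a1 a2] [b1 b2] [x y]; rewrite !expr2 /=; ring.
Qed.

End ComplexPlane.

Section Touching.
Variables (R : realType) (n : nat).
Local Notation Cn := 'rV[R[i]]_n.
Local Notation Re := (@complex.Re R).
Local Notation Im := (@complex.Im R).

(** The viscosity form of plurisubharmonicity: along a complex line, no quadratic with negative
    Laplacian touches [u] from above at [w]. The direction [v] is arbitrary and has to be
    normalised. *)
Lemma psh_no_touching (U : set Cn) (u : Cn -> R) (w v : Cn) (a b : R[i]) (c d : R) :
  plurisubharmonic_on U (fun z => (u z)%:E) -> 0 < c -> 0 < d ->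
  (forall z, sqn z < d -> U (w + z *: v) /\
    u (w + z *: v) <= quadratic (u w) a b z - c * sqn z) -> False.
Proof.
move=> [_ _ psh] c0 d0 H.
(* On the circle of radius [rho] the majorant is a harmonic function minus the
   constant [c rho^2], so subharmonicity forces [u w <= u w - c rho^2]. *)
pose rho := Num.min 1 (d / 2).
have rho0 : 0 < rho by rewrite lt_min ltr01 divr_gt0.
have rhod : rho ^+ 2 < d.
  have [r1 r2] : rho <= 1 /\ rho <= d / 2 by rewrite !ge_min !lexx orbT.
  by rewrite expr2; nra.
pose N := \sum_(k < n) sqn (v 0 k).
have N0 : 0 <= N by apply: sumr_ge0 => k _; exact: sqn_ge0.
(* If [v = 0] there is no line. Adding the inequalities at the four points [rho], [- rho], [i rho],
   [- i rho] cancels both the linear and the quadratic term and leaves [0 <= - 4 c rho^2]. *)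
have [Nz|Nz] := eqVneq N 0.
  have v0 : v = 0.
    apply/rowP => k; rewrite mxE; apply/eqP; rewrite -sqn_eq0.
    by rewrite (psumr_eq0P _ Nz)// => i _; exact: sqn_ge0.
  have {}H z : sqn z = rho ^+ 2 -> 0 <= Re (a * z + b * z ^+ 2) - c * rho ^+ 2.
    move=> zr; have [|_] := H z; first by rewrite zr.
    by rewrite v0 scaler0 addr0 zr /quadratic; lra.
  have h1 := H (rho +i* 0) (sqn_real _).
  have h2 := H (- rho +i* 0); rewrite (sqn_real (- rho)) sqrrN in h2.
  have h3 := H (0 +i* rho); have h4 := H (0 +i* (- rho)).
  rewrite /sqn /= ?sqrrN expr0n /= !add0r in h3 h4.
  have := h1; have := h2 erefl; have := h3 erefl; have := h4 erefl.
  have := mulr_gt0 c0 (exprn_gt0 2 rho0).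
  by case: a b {H h1 h2 h3 h4} => [a1 a2] [b1 b2]; rewrite !expr2 /=; nra.
have {}N0 : 0 < N by rewrite lt_def Nz.
pose s := Num.sqrt N; have s0 : 0 < s by rewrite sqrtr_gt0.
have s2 : s ^+ 2 = N by rewrite sqr_sqrtr// ltW.
pose del := (s^-1)%:C *: v.
have zdel z : z *: del = (z * (s^-1)%:C) *: v by rewrite scalerA.
have sqns z : sqn (z * (s^-1)%:C) = sqn z / N.
  by rewrite sqnM sqn_real exprVn s2.
have Uw : U w by have [] := H 0; rewrite ?scale0r ?addr0// /sqn /= expr0n /= addr0.
have [|_ _ sub] := psh w del Uw.
  transitivity (\sum_(k < n) ((sqn (v 0 k) / N)%:C)).
    apply: eq_bigr => k _; rewrite mxE normc_sqn sqnM sqn_real exprVn s2 mulrC.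
    by rewrite -rmorphXn /= sqr_sqrtr// divr_ge0 ?sqn_ge0// ltW.
  by rewrite -rmorph_sum /= -mulr_suml divff.
have srho : 0 < s * rho by rewrite mulr_gt0.
have sqd z : sqn z <= (s * rho) ^+ 2 -> sqn (z * (s^-1)%:C) < d.
  rewrite sqns exprMn s2 => zr; apply: le_lt_trans rhod.
  by rewrite ler_pdivrMr// mulrC.
(* In the coordinate along the unit vector [del] the circle has radius [s * rho], and [a], [b] are
   divided by [s] and [s ^+ 2]. *)
have := sub 0 (s * rho) srho _
  (quadratic (u w - c * rho ^+ 2) (a * (s^-1)%:C) (b * (s^-1)%:C ^+ 2))
  _ (harmonic_quadratic _ _ _ _) _ 0.
rewrite /open_disc /= subrr normr0 ltcR srho => /(_ _ _ _ isT) H'.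
suff : (u (w + 0 *: del) <= u w - c * rho ^+ 2).
  have := mulr_gt0 c0 (exprn_gt0 2 rho0); rewrite scale0r addr0; lra.
rewrite -lee_fin; apply: le_trans (H' _ _ _) _ => //.
- move=> z; rewrite /closed_disc /= subr0 (normc_le _ (ltW srho)) => zr.
  by have [] := H _ (sqd _ zr); rewrite zdel.
- exact/continuous_subspaceT/quadratic_continuous.
- move=> z; rewrite /circle /= subr0 => /(normc_eq _ (ltW srho)) zr.
  rewrite lee_fin zdel; have [] := H (z * (s^-1)%:C); first by rewrite sqd// zr.
  move=> _ /le_trans; apply; rewrite sqns zr exprMn s2 (mulrC N) mulfK//.
  rewrite /quadratic exprMn; set x := Re _; set y := Re _.
  suff -> : x = y by lra.
  by rewrite /x /y; congr Re; ring.
- by rewrite lee_fin /quadratic expr0n /= !mulr0 addr0 /= addr0.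
Qed.

End Touching.

(** * Maximum principle on discs *)

Section Expansions.
Variables (R : realType) (n : nat).
Local Notation Cn := 'rV[R[i]]_n.
Local Notation Re := (@complex.Re R).
Local Notation Im := (@complex.Im R).
Implicit Types (x y : Cn) (z w a b : R[i]) (g : R[i] -> R[i]).

Lemma ball_rowP x y (d : R) : 0 < d ->
  ball x d%:C y <-> forall k, sqn (y 0 k - x 0 k) < d ^+ 2.
Proof.
move=> d0; have ballE z w : ball z d%:C w <-> sqn (w - z) < d ^+ 2.
  by rewrite -ball_normE /= distrC (normc_lt _ (ltW d0)).
split=> [[_ h] k|h]; first by apply/ballE; exact: h.
split; first by rewrite ltcR.
by move=> i k; rewrite ord1; apply/ballE.
Qed.

Lemma common_radius (T : Type) (m : T -> R) (Q : 'I_n -> T -> Prop) :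
  (forall k, exists2 d, 0 < d & forall t, m t < d -> Q k t) ->
  exists2 d, 0 < d & forall t, m t < d -> forall k, Q k t.
Proof.
move=> h; have /choice[d hd] k : exists d, 0 < d /\ forall t, m t < d -> Q k t.
  by have [d d0 ?] := h k; exists d.
(* The default [1] keeps the radius positive when [n = 0]. *)
exists (\big[Num.min/1]_k d k).
  by apply: (big_ind (fun x : R => 0 < x)) => // [x y x0 y0|k _]; 
    [rewrite lt_min x0|exact: (hd k).1].
move=> t td k; apply: (hd k).2; apply: lt_le_trans td _.
exact: bigmin_le_cond.
Qed.

(** A complex expansion [g (z + h) = g z + a h + b h^2 + o(|h|^2)]; [d] bounds the squared modulus
    of [h]. *)
Definition expansion2 g z a b := forall k, 0 < k -> exists2 d, 0 < d &
  forall h, sqn h < d ->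
    `|Re (g (z + h) - g z - a * h - b * h ^+ 2)| <= k * sqn h /\
    `|Im (g (z + h) - g z - a * h - b * h ^+ 2)| <= k * sqn h.

Lemma sqn_le (z : R[i]) (B : R) :
  `|Re z| <= B -> `|Im z| <= B -> sqn z <= 2 * B ^+ 2.
Proof.
move=> h1 h2; rewrite /sqn mulr_natl mulr2n.
by apply: lerD; rewrite -real_normK ?num_real// lerXn2r// nnegrE (le_trans _ h1).
Qed.

Lemma norm_ReIm_mulX2 b h :
  `|Re (b * h ^+ 2)| <= (`|Re b| + `|Im b|) * sqn h /\
  `|Im (b * h ^+ 2)| <= (`|Re b| + `|Im b|) * sqn h.
Proof.
have [h1 h2] : `|Re (h ^+ 2)| <= sqn h /\ `|Im (h ^+ 2)| <= sqn h.
  case: h => x y; rewrite /sqn !expr2 /= !ler_norml.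
  have := sqr_ge0 (x + y); have := sqr_ge0 (x - y).
  by rewrite !expr2; split; apply/andP; split; nra.
case: b (h ^+ 2) h1 h2 => [b1 b2] [x y] /= h1 h2; split.
  apply: (le_trans (ler_normB _ _)); rewrite !normrM mulrDl.
  by apply: lerD; rewrite ler_wpM2l.
apply: (le_trans (ler_normD _ _)); rewrite !normrM mulrDl.
by apply: lerD; rewrite ler_wpM2l.
Qed.

(** What is subtracted from [w] is [b h^2 + o(|h|^2)], and [|w - b h^2|^2 = |w|^2 - 2 Re (conj w b
    h^2) + O(|h|^4)]. So a squared distance changes by a harmonic term, up to an arbitrarily small
    multiple of [|h|^2]. *)
Lemma expansion2_shift g z a b w c : expansion2 g z a b -> 0 < c ->
  exists2 d, 0 < d & forall h, sqn h < d ->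
    sqn (w - (g (z + h) - g z - a * h)) <=
      sqn w + Re (- 2%:R * (Re w -i* Im w) * b * h ^+ 2) + c * sqn h.
Proof.
move=> eg c0.
pose D := `|Re w| + `|Im w|; pose B := `|Re b| + `|Im b|.
have D0 : 0 <= D by rewrite addr_ge0.
have B0 : 0 <= B by rewrite addr_ge0.
(* This [k] keeps the cross term of [w] with the remainder below [c / 2 * sqn h]; the radius
   [c / (4 * (B + 1) ^+ 2)] below does the same for the fourth-order term. *)
pose k := Num.min 1 (c / (4 * (D + 1))).
have D1 : 0 < 4 * (D + 1) by rewrite mulr_gt0// ltr_wpDl.
have k0 : 0 < k by rewrite lt_min ltr01 divr_gt0.
have [k1 kD] : k <= 1 /\ k * (4 * (D + 1)) <= c.
  by rewrite -ler_pdivlMr// !ge_min !lexx orbT.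
have [d d0 {}eg] := eg _ k0.
have B1 : 0 < 4 * (B + 1) ^+ 2 by rewrite mulr_gt0// exprn_gt0// ltr_wpDl.
exists (Num.min d (c / (4 * (B + 1) ^+ 2))) => [|h]; first by rewrite lt_min d0 divr_gt0.
rewrite lt_min => /andP[/eg]; set E := g _ - _ - _ - _ => -[E1 E2].
rewrite ltr_pdivlMr// => hB; have Z0 := sqn_ge0 h.
have -> : g (z + h) - g z - a * h = b * h ^+ 2 + E by rewrite /E; ring.
have [b1 b2] := norm_ReIm_mulX2 b h; rewrite -/B in b1 b2.
have kZ : k * sqn h <= sqn h by rewrite ler_piMl.
have s : sqn (b * h ^+ 2 + E) <= 2 * ((B + 1) * sqn h) ^+ 2.
  apply: sqn_le.
    have -> : Re (b * h ^+ 2 + E) = Re (b * h ^+ 2) + Re E by case: (b * _) E {E1 E2} => [? ?] [].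
    by apply: (le_trans (ler_normD _ _)); lra.
  have -> : Im (b * h ^+ 2 + E) = Im (b * h ^+ 2) + Im E by case: (b * _) E {E1 E2} => [? ?] [].
  by apply: (le_trans (ler_normD _ _)); lra.
have s' : sqn (b * h ^+ 2 + E) <= c / 2 * sqn h.
  apply: (le_trans s); rewrite exprMn !expr2 in hB *; have := sqn_ge0 h; nra.
have m : - 2 * (Re w * Re E + Im w * Im E) <= c / 2 * sqn h.
  apply: (@le_trans _ _ (2 * (D * (k * sqn h)))).
    have m1 : - (Re w * Re E) <= `|Re w| * (k * sqn h).
      by rewrite (le_trans (ler_norm _))// normrN normrM ler_wpM2l.
    have m2 : - (Im w * Im E) <= `|Im w| * (k * sqn h).
      by rewrite (le_trans (ler_norm _))// normrN normrM ler_wpM2l.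
    by rewrite /D; lra.
  by have := ler_wpM2r Z0 kD; have := mulr_ge0 (ltW k0) Z0; nra.
have -> : sqn (w - (b * h ^+ 2 + E)) = sqn w + Re (- 2%:R * (Re w -i* Im w) * b * h ^+ 2) +
    (- 2 * (Re w * Re E + Im w * Im E) + sqn (b * h ^+ 2 + E)).
  by rewrite /sqn; case: (w) (b) (h ^+ 2) (E) => [? ?] [? ?] [? ?] [? ?] /=; ring.
by rewrite lerD2l; lra.
Qed.

Lemma expansion2_continuous g z a b e : expansion2 g z a b -> 0 < e ->
  exists2 d, 0 < d & forall h, sqn h < d -> sqn (g (z + h) - g z) < e.
Proof.
move=> eg e0; have [d d0 {}eg] := @expansion2_shift g z a b 0 1 eg ltr01.
have a0 : 0 < 2 * (sqn a + 1) by rewrite mulr_gt0// ltr_wpDl// sqn_ge0.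
exists (Num.min d (e / (2 * (sqn a + 1)))) => [|h]; first by rewrite lt_min d0 divr_gt0.
rewrite lt_min ltr_pdivlMr// => /andP[/eg h1 h2].
apply: le_lt_trans h2; move: h1; rewrite sub0r sqnN.
have -> : Re (- 2%:R * (Re 0 -i* Im 0) * b * h ^+ 2) = 0.
  by case: (b) (h ^+ 2) => [? ?] [? ?] /=; ring.
rewrite addr0.
rewrite (_ : sqn 0 = 0) ?add0r ?mul1r; last by rewrite /sqn /= expr0n addr0.
set r := _ - _ - _ => h1.
have -> : g (z + h) - g z = r + a * h by rewrite /r; ring.
apply: (@le_trans _ _ (2 * (sqn r + sqn (a * h)))).
  case: r (a * h) {h1} => [r1 r2] [s1 s2]; rewrite /sqn /= -subr_ge0.
  have -> : 2 * (r1 ^+ 2 + r2 ^+ 2 + (s1 ^+ 2 + s2 ^+ 2)) -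
    ((r1 + s1) ^+ 2 + (r2 + s2) ^+ 2) = (r1 - s1) ^+ 2 + (r2 - s2) ^+ 2 by ring.
  by rewrite addr_ge0// sqr_ge0.
by rewrite sqnM; lra.
Qed.

Definition smooth_at (G : R[i] -> Cn) z := forall k, exists a b,
  expansion2 (fun z => G z 0 k) z a b.

Lemma smooth_at_continuous (G : R[i] -> Cn) z : smooth_at G z -> {for z, continuous G}.
Proof.
move=> sG; apply/(@cvg_ballP _ _ _ (nbhs z)) => e /posc_real[-> e0].
have [d d0 hd] := @common_radius R[i] (fun w => sqn (w - z))
  (fun k w => sqn (G w 0 k - G z 0 k) < Re e ^+ 2) (fun k =>
  let: ex_intro a (ex_intro b h) := sG k in
  let: ex_intro2 d d0 hd := expansion2_continuous h (exprn_gt0 2 e0) in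
  ex_intro2 _ _ d d0 (fun w wd => eq_ind _ (fun v => sqn (G v 0 k - G z 0 k) < Re e ^+ 2)
    (hd _ wd) _ (subrKC z w))).
have := near_sqn z d0; apply: filterS => w /hd wk.
by apply/ball_rowP => //; exact: wk.
Qed.

Lemma disc_compact (r : R) : compact [set z : R[i] | sqn z <= r ^+ 2].
Proof.
have -> : [set z : R[i] | sqn z <= r ^+ 2] =
    (fun p : R * R => p.1 +i* p.2) @` [set p | p.1 ^+ 2 + p.2 ^+ 2 <= r ^+ 2].
  by apply/seteqP; split=> [[x y] h|_ [[x y] h <-]] //; exists (x, y).
apply: continuous_compact; last exact: plane_disc_compact.
apply: continuous_subspaceT => -[x y].
apply/(@cvg_ballP _ _ _ (nbhs (x, y))) => e /posc_real[-> e0].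
have e2 : 0 < Re e / 2 by rewrite divr_gt0.
have : \forall p \near (x, y), ball (x, y) (Re e / 2) p by exact: nbhsx_ballx.
apply: filterS => -[x' y'] [] /=; rewrite -!ball_normE /= => hx hy.
rewrite (normc_lt _ (ltW e0)).
apply: le_lt_trans (@sqn_le ((x +i* y) - (x' +i* y')) _ (ltW hx) (ltW hy)) _.
by rewrite !expr2; nra.
Qed.

Lemma box_compact (r : R) : compact [set v : Cn | forall k, sqn (v 0 k) <= r ^+ 2].
Proof.
by apply: (@rV_compact _ n (fun=> [set z : R[i] | sqn z <= r ^+ 2])) => _; exact: disc_compact.
Qed.

End Expansions.

Section DiscMaximum.
Variables (R : realType) (n : nat).
Local Notation Cn := 'rV[R[i]]_n.
Local Notation Re := (@complex.Re R).
Local Notation Im := (@complex.Im R).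
Implicit Types (U : set Cn) (u : Cn -> R) (G : R[i] -> Cn) (z w a b : R[i]).

Definition sumsqn (v : Cn) : R := \sum_(k < n) sqn (v 0 k).

Lemma sumsqn_continuous : continuous sumsqn.
Proof.
move=> v; rewrite /sumsqn.
apply: (@cvg_big R _ _ _ _ (@add_continuous R^o) _ (nbhs v)) => k _.
have h : (w 0 k) @[w --> nbhs v] --> v 0 k by exact: coord_continuous.
exact: (cvg_comp _ _ h (@sqn_continuous _ _)).
Qed.

Lemma sqn_le_sumsqn (v : Cn) k : sqn (v 0 k) <= sumsqn v.
Proof.
rewrite /sumsqn (bigD1 k)//= lerDl sumr_ge0// => j _; exact: sqn_ge0.
Qed.

Lemma penalised_continuous U u G (e c : R) (p : R[i] * Cn) : open U ->
  {within U, continuous u} -> smooth_at G p.1 -> U (G p.1 + p.2) ->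
  {for p, continuous (fun p => u (G p.1 + p.2) + e * sqn p.1 - c * sumsqn p.2)}.
Proof.
move=> oU cu sG Up.
have hf : fst x @[x --> nbhs p] --> p.1 by exact: cvg_fst.
have hs : snd x @[x --> nbhs p] --> p.2 by exact: cvg_snd.
have hG : G x.1 @[x --> nbhs p] --> G p.1.
  exact: (cvg_comp _ _ hf (smooth_at_continuous sG)).
have hu : u (G x.1 + x.2) @[x --> nbhs p] --> u (G p.1 + p.2).
  apply: (cvg_comp (fun x => G x.1 + x.2) u).
    by apply: (@cvgD _ Cn _ (nbhs p)); [exact: hG|exact: hs].
  move: cu; rewrite continuous_open_subspace// => /(_ (G p.1 + p.2)).
  by rewrite inE; apply.
apply: (@cvgB _ R^o _ (nbhs p)); first apply: (@cvgD _ R^o _ (nbhs p)) => //.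
  apply: (@cvgM _ _ (nbhs p) _ (fun=> e)); first exact: (@cvg_cst R^o e _ (nbhs p)).
  exact: (cvg_comp _ _ hf (@sqn_continuous _ _)).
apply: (@cvgM _ _ (nbhs p) _ (fun=> c)); first exact: (@cvg_cst R^o c _ (nbhs p)).
exact: (cvg_comp _ _ hs (@sumsqn_continuous _)).
Qed.

Lemma unit_disc_interior z : sqn z < 1 -> exists2 d, 0 < d &
  forall h, sqn h < d -> sqn (z + h) < 1.
Proof.
move=> z1; have [|d d0 hd] := @plane_disc_open R 1 (Re z) (Im z).
  by rewrite /plane_disc expr1n.
have d2 : 0 < d / 2 by rewrite divr_gt0.
have dd : d / 2 < d by lra.
exists ((d / 2) ^+ 2) => [|h /ltW hh]; first exact: exprn_gt0.
have := hd _ _ (le_lt_trans (Re_le_sqn (ltW d2) hh) dd)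
  (le_lt_trans (Im_le_sqn (ltW d2) hh) dd).
by rewrite /plane_disc expr1n; case: (z) (h) => [? ?] [].
Qed.

Lemma compact_neighbourhood U u (K : set Cn) (e : R) : open U ->
  {within U, continuous u} -> compact K -> K `<=` U -> 0 < e ->
  exists2 d : R, 0 < d & forall w v : Cn, K w -> (forall k, sqn (v 0 k - w 0 k) < d ^+ 2) ->
    U v /\ `|u v - u w| <= e.
Proof.
move=> oU cu cK KU e0.
have [d1 /posc_real[-> d10] h1] := compact_open_enlargement cK oU KU.
have [d2 /posc_real[-> d20] h2] := compact_uniform_continuous cK KU cu e0.
exists (Num.min (Re d1) (Re d2)) => [|w v Kw vw]; first by rewrite lt_min d10.
have m0 : 0 < Num.min (Re d1) (Re d2) by rewrite lt_min d10.
have Uv : U v.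
  apply: (h1 w) => //; apply/ball_rowP => // k; apply: lt_le_trans (vw k) _.
  by rewrite ler_pXn2r ?nnegrE ?(ltW m0) ?(ltW d10)// ge_min lexx.
split=> //; apply: h2 => //; apply/ball_rowP => // k; apply: lt_le_trans (vw k) _.
by rewrite ler_pXn2r ?nnegrE ?(ltW m0) ?(ltW d20)// ge_min lexx orbT.
Qed.

(* For [u] merely continuous, the chain rule is replaced by doubling the
   variables: [u (G z + v) + e |z|^2 - c |v|^2] is maximised over pairs, and at
   a maximum [(z0, v0)] the point [G z + v] is moved along the complex line
   [w0 + h a] tangent to the disc, the quadratic error being absorbed by [v]. *)
Lemma smooth_disc_maximum U u G (m : R) : open U -> {within U, continuous u} ->
  plurisubharmonic_on U (fun v => (u v)%:E) ->
  (forall z, sqn z <= 1 -> U (G z)) -> (forall z, sqn z <= 1 -> smooth_at G z) ->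
  (forall z, sqn z = 1 -> u (G z) <= m) ->
  forall z, sqn z <= 1 -> u (G z) <= m.
Proof.
move=> oU cu psh UG sG Gm zs zs1; rewrite leNgt; apply/negP => mu.
(* The excess over [m] is [3 e]. On the unit circle [e |z|^2] contributes [e] and the displacement
   by [v] at most [e / 2], which cannot make up for it. *)
pose e := (u (G zs) - m) / 3.
have e0 : 0 < e by rewrite divr_gt0// subr_gt0.
have e3 : u (G zs) = m + 3 * e by rewrite /e; lra.
have e2 : 0 < e / 2 by rewrite divr_gt0.
have cD : compact [set z : R[i] | sqn z <= 1].
  by have := @disc_compact R 1; rewrite expr1n.
have cK : compact (G @` [set z : R[i] | sqn z <= 1]).
  apply: continuous_compact => //; apply: continuous_in_subspaceT => z.
  by rewrite inE => /sG /smooth_at_continuous.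
have KU : G @` [set z : R[i] | sqn z <= 1] `<=` U by move=> _ [z z1 <-]; exact: UG.
have [d d0 hd] := compact_neighbourhood oU cu cK KU e2.
pose eta := d / 2; have eta0 : 0 < eta by rewrite divr_gt0.
have near z (v : Cn) : sqn z <= 1 -> (forall k, sqn (v 0 k) <= eta ^+ 2) ->
    U (G z + v) /\ `|u (G z + v) - u (G z)| <= e / 2.
  move=> z1 hv; apply: hd; first by exists z.
  move=> k; rewrite mxE addrAC subrr add0r; apply: le_lt_trans (hv k) _.
  by rewrite ltr_pXn2r ?nnegrE ?(ltW eta0) ?(ltW d0)// /eta; lra.
(* Since [u] varies by at most [e / 2] over the box, this penalty forces [|v0|^2 <= eta^2 / 2] at a
   maximum: [v0] is interior, with room to move. *)
pose c := e / eta ^+ 2; have c0 : 0 < c by rewrite divr_gt0// exprn_gt0.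
pose A := [set z : R[i] | sqn z <= 1] `*` [set v : Cn | forall k, sqn (v 0 k) <= eta ^+ 2].
have zero_in : (forall k, sqn ((0 : Cn) 0 k) <= eta ^+ 2).
  by move=> k; rewrite mxE /sqn /= expr0n /= addr0 sqr_ge0.
have [|||[z0 v0]] := @compact_EVT_max _ R
    (fun p => u (G p.1 + p.2) + e * sqn p.1 - c * sumsqn p.2) A.
- by exists (zs, 0); split.
- by apply: compact_setX cD _; exact: box_compact.
- apply: continuous_in_subspaceT => -[z v]; rewrite inE => -[/= z1 v1].
  have [Uv _] := near _ _ z1 v1.
  exact: (@penalised_continuous U u G e c (z, v) oU cu (sG _ z1) Uv).
rewrite inE => -[/= z01 v01] max.
have {}max z (v : Cn) : sqn z <= 1 -> (forall k, sqn (v 0 k) <= eta ^+ 2) ->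
    u (G z + v) + e * sqn z - c * sumsqn v <=
    u (G z0 + v0) + e * sqn z0 - c * sumsqn v0.
  by move=> z1 v1; apply: (max (z, v)); rewrite inE.
have sum0 : sumsqn 0 = 0.
  by rewrite /sumsqn big1// => k _; rewrite mxE /sqn /= expr0n addr0.
have v0small : sumsqn v0 <= eta ^+ 2 / 2.
  have := max z0 0 z01 zero_in; rewrite addr0 sum0 mulr0 subr0 => h.
  have [_] := near z0 v0 z01 v01; rewrite ler_norml => /andP[_ h'].
  rewrite -(ler_pM2l c0); have -> : c * (eta ^+ 2 / 2) = e / 2.
    by rewrite /c; field; rewrite gt_eqF.
  by lra.
have z0lt : sqn z0 < 1.
  rewrite lt_neqAle z01 andbT; apply/eqP => z0e.
  have := max zs 0 zs1 zero_in; rewrite addr0 sum0 mulr0 subr0 z0e e3.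
  have := Gm _ z0e; have := mulr_ge0 (ltW e0) (sqn_ge0 zs).
  have : 0 <= c * sumsqn v0 by rewrite mulr_ge0 ?(ltW c0)// sumr_ge0// => k _; exact: sqn_ge0.
  have [_] := near z0 v0 z01 v01; rewrite ler_norml => /andP[_]; lra.
have /choice[ab hab] k : exists ab, expansion2 (fun z => G z 0 k) z0 ab.1 ab.2.
  by have [a [b h]] := sG z0 z01 k; exists (a, b).
pose bt k : R[i] := - 2%:R * (Re (v0 0 k) -i* Im (v0 0 k)) * (ab k).2.
(* The displacement that keeps [G (z0 + h) + v] on the line [G z0 + v0 + h a]. *)
pose err k h := v0 0 k - (G (z0 + h) 0 k - G z0 0 k - (ab k).1 * h).
(* The [n] coordinate errors, weighted by [c], then total at most [e / 2 * sqn h]; [n.+1] avoids a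
   division by zero. *)
pose c' : R := eta ^+ 2 / (2 * n.+1%:R).
have c'0 : 0 < c' by rewrite divr_gt0 ?exprn_gt0// mulr_gt0.
have [d1 d10 H1] := @common_radius R n R[i] (@sqn R)
  (fun k h => sqn (err k h) <= sqn (v0 0 k) + Re (bt k * h ^+ 2) + c' * sqn h)
  (fun k => expansion2_shift (v0 0 k) (hab k) c'0).
have [d2 d20 H2] : exists2 d2, 0 < d2 & forall h, sqn h < d2 ->
    forall k, Re (bt k * h ^+ 2) + c' * sqn h <= eta ^+ 2 / 2.
  apply: common_radius => k; pose B := `|Re (bt k)| + `|Im (bt k)| + c'.
  have B0 : 0 < B by rewrite ltr_wpDl// addr_ge0.
  exists (eta ^+ 2 / 2 / B) => [|h]; first by rewrite !divr_gt0// exprn_gt0.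
  rewrite ltr_pdivlMr// mulrC => /ltW; apply: le_trans.
  rewrite /B mulrDl lerD2r; apply: le_trans (norm_ReIm_mulX2 _ _).1.
  exact: ler_norm.
have [d3 d30 H3] := unit_disc_interior z0lt.
pose a := \row_k (ab k).1.
(* Maximality bounds the increment of [u] by [e (|z0|^2 - |z0 + h|^2) + c (|v|^2 - |v0|^2)]. The
   first term is [Re (- 2 e conj z0 h) - e |h|^2], the second at most
   [c Re (sum bt h^2) + e / 2 |h|^2]; a loss of [e / 2 |h|^2] remains. *)
apply: (@psh_no_touching R n U u (G z0 + v0) a
  ((- 2 * e * Re z0) +i* (2 * e * Im z0)) (c%:C * \sum_k bt k) (e / 2)
  (Num.min d1 (Num.min d2 d3))) => //; first by rewrite !lt_min d10 d20.
move=> h; rewrite !lt_min => /and3P[h1 h2 h3].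
pose v := \row_k err k h.
have Gv : G z0 + v0 + h *: a = G (z0 + h) + v.
  by apply/rowP => k; rewrite !mxE /err; ring.
have zh1 := ltW (H3 _ h3).
have hv k : sqn (v 0 k) <= eta ^+ 2.
  rewrite mxE; apply: le_trans (H1 _ h1 k) _; rewrite -addrA.
  by have := H2 _ h2 k; have := le_trans (sqn_le_sumsqn v0 k) v0small; lra.
rewrite Gv; split; first by have [] := near _ _ zh1 hv.
have := max _ _ zh1 hv.
have sv : sumsqn v <= sumsqn v0 + \sum_k Re (bt k * h ^+ 2) + n%:R * (c' * sqn h).
  have -> : n%:R * (c' * sqn h) = \sum_(k < n) (c' * sqn h).
    by rewrite sumr_const card_ord mulr_natl.
  rewrite /sumsqn -!big_split /=.
  by apply: ler_sum => k _; rewrite mxE; exact: H1.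
have nc : c * (n%:R * (c' * sqn h)) <= e / 2 * sqn h.
  have -> : c * (n%:R * (c' * sqn h)) = e / 2 * (n%:R / n.+1%:R) * sqn h.
    rewrite /c /c'; field; rewrite [X in X != 0](_ : _ = n.+1%:R) ?pnatr_eq0 ?gt_eqF//.
    by rewrite -natr1 addrC.
  apply: ler_wpM2r; first exact: sqn_ge0.
  by rewrite ler_piMr ?(ltW e2)// ler_pdivrMr// mul1r ler_nat.
have {}sv : c * sumsqn v <= c * sumsqn v0 + c * (\sum_k Re (bt k * h ^+ 2)) +
    c * (n%:R * (c' * sqn h)) by rewrite -!mulrDr ler_wpM2l// ltW.
rewrite /quadratic.
have -> : Re (((- 2 * e * Re z0) +i* (2 * e * Im z0)) * h +
    (c%:C * \sum_k bt k) * h ^+ 2) =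
  e * (sqn z0 + sqn h - sqn (z0 + h)) + c * \sum_k Re (bt k * h ^+ 2).
  have -> : \sum_k Re (bt k * h ^+ 2) = Re ((\sum_k bt k) * h ^+ 2).
    have ReD z w : Re (z + w) = Re z + Re w by case: z w => [? ?] [].
    by rewrite mulr_suml; elim/big_rec2: _ => // k x y _ ->; rewrite ReD.
  move: (\sum_k bt k) => B; rewrite -[B]/(B : R[i]).
  by case: (z0) (h) (B : R[i]) => [? ?] [? ?] [? ?]; rewrite /sqn !expr2 /=; ring.
have -> : e * (sqn z0 + sqn h - sqn (z0 + h)) =
  e * sqn z0 + (e / 2 * sqn h + e / 2 * sqn h) - e * sqn (z0 + h) by field.
move: sv nc.
move: (c * sumsqn v) (c * sumsqn v0) (c * \sum_k _) (c * (n%:R * _)) (e / 2 * _).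
by move: (e * sqn z0) (e * sqn (z0 + h)) (u _) (u _) => *; lra.
Qed.

End DiscMaximum.

(** * Passage from smooth discs to continuous holomorphic discs *)

Section HolomorphicDisc.
Variables (R : realType) (n : nat).
Local Notation Cn := 'rV[R[i]]_n.
Local Notation Re := (@complex.Re R).
Local Notation Im := (@complex.Im R).
Implicit Types (U : set Cn) (u : Cn -> R) (G S : R[i] -> Cn) (z w : R[i]).

Lemma closed_unit_discP z : closed_disc 0 1 z <-> sqn z <= 1.
Proof. by rewrite /closed_disc /= subr0 (normc_le _ ler01) expr1n. Qed.

Lemma open_unit_discP z : open_disc 0 1 z <-> sqn z < 1.
Proof. by rewrite /open_disc /= subr0 (normc_lt _ ler01) expr1n. Qed.

Lemma unit_circleP z : circle 0 1 z <-> sqn z = 1.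
Proof. by rewrite /circle /= subr0 (normc_eq _ ler01) expr1n. Qed.

(** The complex derivative acts by multiplication by [l 0 k]; the real and imaginary parts of its
    remainder give gradients of Cauchy-Riemann form. *)
Lemma derivable_hol_pair S k x y : derivable S (x +i* y) 1 -> exists a b : R,
  hol_pair (fun x y => Re (S (x +i* y) 0 k)) (fun x y => Im (S (x +i* y) 0 k)) x y a b.
Proof.
set z := x +i* y => /cvg_ex[/= l hl].
have {}hl : (h^-1 *: (S (h *: (1 : R[i]) + z) - S z)) 0 k @[h --> (0 : R[i])^'] --> l 0 k.
  exact: (cvg_comp _ _ hl (@coord_continuous R[i] 1 n 0 k l)).
exists (Re (l 0 k)), (Im (l 0 k)).
have key (e : R) : 0 < e -> exists2 d, 0 < d & forall s t, `|s| < d -> `|t| < d ->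
    sqn (S ((x + s) +i* (y + t)) 0 k - S z 0 k - l 0 k * (s +i* t)) <=
    (e * (`|s| + `|t|)) ^+ 2.
  move=> e0; have eC : 0 < e%:C by rewrite ltcR.
  move/cvgrPdist_le : hl => /(_ _ eC); rewrite /dnbhs /= near_withinE near_simpl.
  move=> /nbhs_ballP[d /= /posc_real[-> d0] hd].
  have d2 : 0 < Re d / 2 by rewrite divr_gt0.
  exists (Re d / 2) => // s t sd td; set h := s +i* t.
  have hle : sqn h <= (`|s| + `|t|) ^+ 2.
    rewrite /sqn /= sqrrD !real_normK ?num_real//.
    by rewrite lerD2r lerDl mulrn_wge0// mulr_ge0.
  have [h0|h0] := eqVneq h 0.
    have -> : (x + s) +i* (y + t) = z.
      by case: h0 => -> ->; rewrite !addr0.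
    by rewrite subrr h0 mulr0 subr0 /sqn /= expr0n /= addr0 sqr_ge0.
  have := hd h; rewrite /ball /= sub0r normrN (normc_lt _ (ltW d0)).
  have hd' : sqn h < Re d ^+ 2.
    apply: le_lt_trans hle _; rewrite ltr_pXn2r ?nnegrE ?addr_ge0 ?(ltW d0)//.
    by lra.
  move=> /(_ hd' h0); rewrite !mxE.
  have -> : h *: 1 + z = (x + s) +i* (y + t).
    by rewrite /GRing.scale /= mulr1 addrC.
  rewrite (normc_le _ (ltW e0)) => H.
  have -> : S ((x + s) +i* (y + t)) 0 k - S z 0 k - l 0 k * h =
     - ((l 0 k - h^-1 * (S ((x + s) +i* (y + t)) 0 k - S z 0 k)) * h) by field.
  rewrite sqnN sqnM exprMn; apply: ler_pM => //; exact: sqn_ge0.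
split=> e e0; have [d d0 hd] := key e e0; exists d => // s t sd td;
  have := hd s t sd td; have e' : 0 <= e * (`|s| + `|t|) by rewrite mulr_ge0 ?addr_ge0 ?(ltW e0).
- move=> /(Re_le_sqn e'); congr (`|_| <= _).
  by case: (S _ 0 k) (S z 0 k) (l 0 k) => [? ?] [? ?] [? ?] /=; ring.
- move=> /(Im_le_sqn e'); congr (`|_| <= _).
  by case: (S _ 0 k) (S z 0 k) (l 0 k) => [? ?] [? ?] [? ?] /=; ring.
Qed.

Lemma has_grad_dilate (p : R -> R -> R) (c x y A B : R) : has_grad p (c * x) (c * y) A B ->
  has_grad (fun x y => p (c * x) (c * y)) x y (A * c) (B * c).
Proof.
move=> hp e e0; have c1 : 0 < `|c| + 1 by rewrite ltr_wpDl.
have [d d0 hd] := hp _ (divr_gt0 e0 c1).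
exists (d / (`|c| + 1)) => [|s t]; first exact: divr_gt0.
have small (v : R) : `|v| < d / (`|c| + 1) -> `|c * v| < d.
  by rewrite ltr_pdivlMr// mulrC normrM; apply: le_lt_trans; rewrite ler_wpM2r// lerDl.
move=> /small cs /small ct; have := hd _ _ cs ct.
rewrite -!mulrDr => /le_trans h; rewrite -!mulrA; apply: h.
rewrite !normrM -mulrDr mulrAC ler_pdivrMr//.
by rewrite -mulrA ler_wpM2l ?(ltW e0)// mulrC ler_wpM2l ?addr_ge0// lerDl.
Qed.

Lemma continuous_within_component S (A : set R[i]) (f : R[i] -> R) k :
  continuous f -> {within A, continuous S} ->
  {within A, continuous (fun z => f (S z 0 k))}.
Proof.
move=> cf /subspace_continuousP cS; apply/subspace_continuousP => z Az.
have h : (S w 0 k) @[w --> within A (nbhs z)] --> S z 0 k.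
  exact: (cvg_comp _ _ (cS z Az) (@coord_continuous R[i] 1 n 0 k (S z))).
exact: (cvg_comp _ _ h (cf _)).
Qed.

(** It is [S (rho z)] with [rho < 1] that is smoothed: it is uniformly close to [S] on the closed
    disc, and complex differentiable on the disc of radius [rho^-1]. This leaves room for the
    smoothing and yields expansions on the unit circle too. *)
Lemma holomorphic_disc_approximation S (e : R) : holomorphic_disc S -> 0 < e ->
  exists G, (forall z, sqn z <= 1 -> smooth_at G z) /\
    forall z, sqn z <= 1 -> forall k, sqn (G z 0 k - S z 0 k) <= e ^+ 2.
Proof.
move=> [cS dS] e0; have e4 : 0 < e / 4 by rewrite divr_gt0.
have cD : compact (closed_disc 0 1 : set R[i]).
  have -> : closed_disc 0 1 = [set z : R[i] | sqn z <= 1 ^+ 2].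
    by apply/seteqP; split=> z; rewrite /= expr1n => /closed_unit_discP.
  exact: disc_compact.
have unif (f : R[i] -> R) k : continuous f -> exists2 d, 0 < d &
    forall z w, sqn z <= 1 -> sqn w <= 1 -> sqn (w - z) < d ->
    `|f (S w 0 k) - f (S z 0 k)| <= e / 4.
  move=> cf; have [d /posc_real[-> d0] hd] := compact_uniform_continuous cD (@subset_refl _ _)
    (@continuous_within_component S _ f k cf cS) e4.
  exists (Re d ^+ 2) => [|z w z1 w1 zw]; first exact: exprn_gt0.
  apply: hd; [exact/closed_unit_discP|exact/closed_unit_discP|].
  by rewrite -ball_normE /= distrC (normc_lt _ (ltW d0)).
have [|d d0 hd] := @common_radius R n (R[i] * R[i])%type (fun p => sqn (p.2 - p.1))
  (fun k p => sqn p.1 <= 1 -> sqn p.2 <= 1 ->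
    `|Re (S p.2 0 k) - Re (S p.1 0 k)| <= e / 4 /\
    `|Im (S p.2 0 k) - Im (S p.1 0 k)| <= e / 4).
  move=> k; have [d1 d10 h1] := unif Re k (@Re_continuous R).
  have [d2 d20 h2] := unif Im k (@Im_continuous R).
  exists (Num.min d1 d2) => [|p]; first by rewrite lt_min d10.
  by rewrite lt_min => /andP[p1 p2] q1 q2; split; [exact: h1|exact: h2].
(* [|rho z - z|^2 = tau^2 |z|^2], and the two bounds give [tau^2 <= d / 4]. *)
pose tau := Num.min (1 / 2) (d / 2).
have tau0 : 0 < tau by rewrite lt_min !divr_gt0.
have [tau1 taud] : tau <= 1 / 2 /\ tau <= d / 2 by rewrite !ge_min !lexx orbT.
pose rho := 1 - tau; have [rho0 rho1] : 0 < rho /\ rho < 1 by rewrite /rho; split; lra.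
have r1 : 1 < rho^-1 by rewrite invf_gt1.
pose r' := (1 + rho^-1) / 2.
have [r'1 r'r] : 1 < r' /\ r' < rho^-1 by rewrite /r'; split; lra.
have /choice[pq hpq] k : exists pq : (R -> R -> R) * (R -> R -> R),
    forall x y, plane_disc r' x y ->
    [/\ `|pq.1 x y - Re (S ((rho * x) +i* (rho * y)) 0 k)| <= e / 4,
      `|pq.2 x y - Im (S ((rho * x) +i* (rho * y)) 0 k)| <= e / 4 &
      exists a b, expansion2 (fun z => pq.1 (Re z) (Im z) +i* pq.2 (Re z) (Im z))
        (x +i* y) a b].
  have [|||x y xy|p [q h]] := @hol_approximation R
    (fun x y => Re (S ((rho * x) +i* (rho * y)) 0 k))
    (fun x y => Im (S ((rho * x) +i* (rho * y)) 0 k)) rho^-1 r' (e / 4) => //.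
  - by lra.
  - have : open_disc 0 1 ((rho * x) +i* (rho * y)).
      apply/open_unit_discP; rewrite /sqn /= !exprMn -mulrDr.
      by rewrite mulrC -ltr_pdivlMr ?exprn_gt0// div1r -exprVn.
    move=> /dS /(derivable_hol_pair k)[a [b [h1 h2]]].
    exists (a * rho), (b * rho); split; last exact: (has_grad_dilate h2).
    by rewrite -mulNr; exact: (has_grad_dilate h1).
  exists (p, q) => x y /h[h1 h2 [a [b [A [B H]]]]]; split=> //.
  exists (a +i* b), (A +i* B) => c c0; have [dd dd0 {}H] := H _ c0.
  have dd2 : 0 < dd / 2 by rewrite divr_gt0.
  have ddl : dd / 2 < dd by lra.
  exists ((dd / 2) ^+ 2) => [|[s t] /ltW st]; first exact: exprn_gt0.
  have [] := H _ _ (le_lt_trans (Re_le_sqn (ltW dd2) st) ddl)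
    (le_lt_trans (Im_le_sqn (ltW dd2) st) ddl).
  by move=> H1 H2; split; [move: H1|move: H2]; congr (`|_| <= _); rewrite !expr2 /=; ring.
have in_disc z : sqn z <= 1 -> plane_disc r' (Re z) (Im z).
  by move=> /le_lt_trans; apply; rewrite expr2; nra.
exists (fun z => \row_k ((pq k).1 (Re z) (Im z) +i* (pq k).2 (Re z) (Im z))).
split=> z z1.
  move=> k; have [_ _ [a [b H]]] := hpq k _ _ (in_disc z z1); exists a, b.
  have -> : (fun z => (\row_k ((pq k).1 (Re z) (Im z) +i* (pq k).2 (Re z) (Im z))) 0 k) =
    (fun z => (pq k).1 (Re z) (Im z) +i* (pq k).2 (Re z) (Im z)).
    by apply/funext => w; rewrite mxE.
  by case: z z1 H.
move=> k; rewrite mxE; have [h1 h2 _] := hpq k _ _ (in_disc z z1).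
have rz : (rho * Re z) +i* (rho * Im z) = rho%:C * z.
  by case: (z) => ? ?; apply/eqP; rewrite eq_complex /= !mul0r subr0 addr0 !eqxx.
rewrite rz in h1 h2.
have pd : sqn (rho%:C * z - z) < d.
  have -> : rho%:C * z - z = - (tau%:C * z).
    by rewrite /rho rmorphB rmorph1; ring.
  rewrite sqnN sqnM sqn_real expr2; have := sqn_ge0 z; nra.
have q : sqn (rho%:C * z) <= 1.
  by rewrite sqnM sqn_real expr2; have := sqn_ge0 z; nra.
have [/= h3 h4] := hd (z, rho%:C * z) pd k z1 q.
(* The real and imaginary parts are each off by [e / 4] from the smoothing and [e / 4] from the
   dilation. *)
apply: (@le_trans _ _ (2 * (e / 2) ^+ 2)); last by rewrite !expr2; nra.
apply: sqn_le; move: h1 h2 h3 h4; rewrite /=.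
- case: (S z 0 k) (S (rho%:C * z) 0 k) => [? ?] [x2 ?] /= h1 _ h3 _.
  by apply: le_trans (ler_distD x2 _ _) _; lra.
- case: (S z 0 k) (S (rho%:C * z) 0 k) => [? ?] [? y2] /= _ h2 _ h4.
  by apply: le_trans (ler_distD y2 _ _) _; lra.
Qed.

(** The image of the closed disc is compact in [U], so a close enough smooth disc stays in [U] and
    changes [u] by at most [e / 2], once on the circle and once at [z]. *)
Lemma holomorphic_disc_maximum U u S (m : R) : open U -> {within U, continuous u} ->
  plurisubharmonic_on U (fun v => (u v)%:E) -> holomorphic_disc S ->
  (forall z, sqn z <= 1 -> U (S z)) -> (forall z, sqn z = 1 -> u (S z) <= m) ->
  forall z, sqn z <= 1 -> u (S z) <= m.
Proof.
move=> oU cu psh hS US Sm z z1; apply/ler_addgt0Pr => e e0.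
have e2 : 0 < e / 2 by rewrite divr_gt0.
have DE : closed_disc 0 1 = [set z : R[i] | sqn z <= 1].
  by apply/seteqP; split=> w /closed_unit_discP.
have cK : compact (S @` [set z : R[i] | sqn z <= 1]).
  apply: continuous_compact; first by rewrite -DE; case: hS.
  by have := @disc_compact R 1; rewrite expr1n.
have KU : S @` [set z : R[i] | sqn z <= 1] `<=` U by move=> _ [w w1 <-]; exact: US.
have [d d0 hd] := compact_neighbourhood oU cu cK KU e2.
have d2 : 0 < d / 2 by rewrite divr_gt0.
have [G [sG GS]] := holomorphic_disc_approximation hS d2.
have near w : sqn w <= 1 -> U (G w) /\ `|u (G w) - u (S w)| <= e / 2.
  move=> w1; apply: hd; first by exists w.
  move=> k; apply: le_lt_trans (GS w w1 k) _.
  by rewrite ltr_pXn2r ?nnegrE ?(ltW d0) ?(ltW d2)//; lra.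
have Gm : u (G z) <= m + e / 2.
  apply: (smooth_disc_maximum oU cu psh _ sG) => // w w1; first by have [] := near w w1.
  have [|_] := near w; first by rewrite w1.
  by rewrite ler_norml => /andP[_]; have := Sm _ w1; lra.
by have [_] := near z z1; rewrite ler_norml => /andP[+ _]; lra.
Qed.

End HolomorphicDisc.

Theorem theorem4p15 (R : realType) (n : nat) (U : set 'rV[R[i]]_n) :
  domain U -> pseudoconvex U -> continuity_principle U.
Proof.
move=> [oU _] [u [cu psh exh]] S B T hS SU cB BU _ SB ST t Tt.
(* Near [B] the function exceeds its maximum [m] on [B] by at most [1]; any fixed margin would
   serve. *)
have [d d0 hd] := compact_neighbourhood oU cu cB BU (@ltr01 R).
have [m hm] : exists m, forall w, B w -> u w <= m.
  have [->|/set0P B0] := eqVneq B set0; first by exists 0.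
  have [|c _ hc] := @compact_EVT_max _ R u B B0 cB.
    exact: (@continuous_subspaceW _ _ B U u BU cu).
  by exists (u c) => w Bw; apply: hc; rewrite inE.
have [J hJ] := SB d d0.
have Sm j z : (J <= j)%N -> sqn z <= 1 -> u (S j z) <= m + 1.
  move=> /hJ[bd _]; apply: holomorphic_disc_maximum psh (hS j) _ _ z => //.
    move=> z; rewrite le_eqVlt => /predU1P[z1|z1]; apply: (SU j).
      by right; exists z => //; exact/unit_circleP.
    by left; exists z => //; exact/open_unit_discP.
  move=> z z1; have [|w Bw] := bd (S j z); first by exists z => //; exact/unit_circleP.
  move=> zw; have [|_] := hd w (S j z) Bw.
    apply/ball_rowP => //; rewrite -ball_normE /= distrC; exact: zw.
  by rewrite ler_norml => /andP[_]; have := hm _ Bw; lra.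
(* The sublevel set is compact by exhaustion, hence closed in the whole space and not merely
   relative to [U]; so the limit point [t] cannot escape to the boundary of [U]. *)
have : closed (U `&` [set z | u z <= m + 1]).
  apply: compact_closed (exh _); exact: norm_hausdorff.
move=> /closure_id clK; suff : (U `&` [set z | u z <= m + 1]) t by case.
rewrite clK => V /nbhs_ballP[e /= /posc_real[-> e0] hV].
(* Beyond [J] the disc lies in the sublevel set, beyond [J'] it comes within [Re e] of [t]. *)
have [J' /(_ (maxn J J') (leq_maxr _ _))[_ /(_ _ Tt)[w [z z1 <-] tz]]] := ST _ e0.
exists (S (maxn J J') z); split; last by apply: hV; rewrite -ball_normE.
split; first by apply: (SU (maxn J J')); left; exists z.
by apply: Sm; [exact: leq_maxl|exact/ltW/open_unit_discP].
Qed.
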